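(* Let $X$ be a real-valued random variable and let $Y$ be an independent symmetrizer of $X$. (1) If $X\sim\mathrm{Exp}(\lambda)$ is an exponential random variable with $\lambda>0$, then $Y$ is absolutely continuous (with respect to Lebesgue measure), and, for all $\alpha>0$, $$h_\alpha(Y)\ge h_\alpha(X),\qquad T_\alpha(Y)\ge T_\alpha(X),\qquad \mathrm{Var}(Y)\ge \mathrm{Var}(X),$$ where $T_\alpha$ is the continuous Tsallis entropy. (2) If $X\sim\mathrm{Geom}(p)$ is a geometric random variable with $0<p<1$, and $Y$ is integer-valued, then, for all $\alpha>0$, $$H_\alpha(Y)\ge H_\alpha(X),\qquad T_\alpha(Y)\ge T_\alpha(X),\qquad \mathrm{Var}(Y)\ge \mathrm{Var}(X),$$ where $T_\alpha$ is the discrete Tsallis entropy. Moreover, equality in each of these comparisons (for each fixed $\alpha>0$ in the case of the entropies) holds if and only if $Y$ is an independent copy of $-X$, i.e. $Y$ has the same distribution as $-X$.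
   Context: A random variable $Y$ is an independent symmetrizer of a random variable $X$ if $Y$ is independent of $X$ and the distribution of $X+Y$ is symmetric about the origin (i.e. $X+Y$ and $-(X+Y)$ have the same distribution). $X\sim\mathrm{Exp}(\lambda)$ means that $X$ has density $f_X(x)=\lambda e^{-\lambda x}\mathbf 1_{[0,\infty)}(x)$. $X\sim\mathrm{Geom}(p)$ means that $X$ has probability mass function $f_X(k)=pq^k$ for $k\in\mathbb Z_{\ge 0}$, where $q=1-p$. Continuous entropies. If $X$ is real-valued with density $f$ with respect to Lebesgue measure, then for $\alpha\in(0,1)\cup(1,\infty)$ the Rényi entropy is $$h_\alpha(X)=\frac1{1-\alpha}\log\int_{\mathbb R}f(x)^\alpha\,dx$$ and the Tsallis entropy is $$T_\alpha(X)=\frac1{1-\alpha}\Big(\int_{\mathbb R}f(x)^\alpha\,dx-1\Big).$$ For $\alpha=1$ both are defined as the Boltzmann–Shannon entropy $h(X)=-\int_{\mathbb R}f(x)\log f(x)\,dx$. Discrete entropies. If $X$ is integer-valued with probability mass function $\{f(k)\}_{k\in\mathbb Z}$, then for $\alpha\in(0,1)\cup(1,\infty)$ $$H_\alpha(X)=\frac1{1-\alpha}\log\sum_{k\in\mathbb Z}f(k)^\alpha,\qquad T_\alpha(X)=\frac1{1-\alpha}\Big(\sum_{k\in\mathbb Z}f(k)^\alpha-1\Big).$$ For $\alpha=1$ both are defined as the Shannon entropy $H(X)=-\sum_{k\in\mathbb Z}f(k)\log f(k)$. Conventions: $0\log 0=0$; entropies are extended-real-valued (they may be infinite); $\mathrm{Var}(Y)=\infty$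 if $Y$ does not have a finite second moment. *)

(* Defs.v *)
From HB Require Import structures.
From mathcomp Require Import all_boot all_order all_algebra.
From mathcomp Require Import all_classical all_reals all_analysis.

Set Implicit Arguments.
Unset Strict Implicit.
Unset Printing Implicit Defensive.

Import Order.TTheory GRing.Theory Num.Theory.
Import numFieldNormedType.Exports.

Local Open Scope classical_set_scope.
Local Open Scope ring_scope.

Definition same_law d (T : measurableType d) (R : realType)
    (P : probability T R) (X Y : T -> R) :=
  forall A : set R, measurable A -> P (X @^-1` A) = P (Y @^-1` A).

Section random_variables.
Context d (T : measurableType d) (R : realType) (P : probability T R).
Implicit Types X Y : {RV P >-> R}.

Definition independent X Y := forall A B : set R,
  measurable A -> measurable B ->
  P (X @^-1` A `&` Y @^-1` B) = (P (X @^-1` A) * P (Y @^-1` B))%E.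

Definition independent_symmetrizer X Y :=
  independent X Y /\ same_law P (X \+ Y) (\- (X \+ Y)).

Definition is_density X (f : R -> R) :=
  [/\ measurable_fun [set: R] f, forall x, 0 <= f x &
      forall A : set R, measurable A ->
        distribution P X A = (\int[lebesgue_measure]_(x in A) (f x)%:E)%E].

Definition exponential_rv X (lambda : R) :=
  is_density X (exponential_pdf lambda).

(* The masses p q^k, k >= 0, add up to 1, so they determine the law of X. *)
Definition geometric_rv X (p : R) :=
  forall k : nat, pmf X k%:R = p * (1 - p) ^+ k.

Definition integer_valued X := {ae P, forall w, X w \is a Num.int}.

Definition pmfZ X (k : int) : R := pmf X k%:~R.

End random_variables.

Section entropies.
Context (R : realType).
Local Open Scope ereal_scope.
Implicit Types (alpha : R) (f : R -> R) (g : int -> R).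

(* The continuous entropies take a density, the discrete ones a mass function.
   As ln 0 = 0 and 0 `^ alpha = 0 for alpha != 0, points where f or g vanishes
   do not contribute; lne +oo = +oo gives the infinite values. *)
Definition shannon f : \bar R :=
  - \int[lebesgue_measure]_x (f x * ln (f x))%:E.

Definition renyi alpha f : \bar R :=
  if alpha == 1%R then shannon f
  else (1 - alpha)^-1%:E * lne (\int[lebesgue_measure]_x (f x `^ alpha)%:E).

Definition tsallis alpha f : \bar R :=
  if alpha == 1%R then shannon f
  else (1 - alpha)^-1%:E * (\int[lebesgue_measure]_x (f x `^ alpha)%:E - 1).

(* esum is meant for nonnegative families, hence the minus sign inside: a mass
   function takes its values in [0, 1], so that - g k * ln (g k) >= 0. *)
Definition dshannon g : \bar R :=
  \esum_(k in [set: int]) (- (g k * ln (g k)))%:E.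

Definition drenyi alpha g : \bar R :=
  if alpha == 1%R then dshannon g
  else (1 - alpha)^-1%:E * lne (\esum_(k in [set: int]) (g k `^ alpha)%:E).

Definition dtsallis alpha g : \bar R :=
  if alpha == 1%R then dshannon g
  else (1 - alpha)^-1%:E * (\esum_(k in [set: int]) (g k `^ alpha)%:E - 1).

End entropies.

(* Main.v *)
From HB Require Import structures.
Require Import Defs.
From mathcomp Require Import all_boot all_order all_algebra.
From mathcomp Require Import all_classical all_reals all_analysis.
From mathcomp Require Import measurable_realfun ring lra zify.
Import Order.TTheory GRing.Theory Num.Theory.
Import numFieldNormedType.Exports.

Set Implicit Arguments.
Unset Strict Implicit.
Unset Printing Implicit Defensive.

Local Open Scope classical_set_scope.
Local Open Scope ring_scope.

(** Let X be exponential of rate lambda and let S = X + Y be symmetric. By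
    independence the tail K x = P (S > x) is the mean of exp_tail (x - Y), so its
    hazard rate is at most lambda, and - K' = lambda (K - P (Y > x)) in the sense
    of finite differences (smooth_hazard, smooth_decay_ge, smooth_decay_le).
    Symmetry says K x + K (- x) = 1. Applying the difference equation at x and at
    - x gives P (Y > x) + P (Y <= - x) = 2 K x: the variables |Y| and |S| have the
    same law (two_sided_tailE, tail_abs_exponential). Everything follows from this
    tail 2 K x of |Y|, which starts at 1 and has hazard rate at most lambda.

    - It is Lipschitz, whence the absolute continuity of Y, and it dominates
      exp (- lambda x), so |Y| dominates X stochastically. Since E Y = - E X, the
      tail formula for second moments compares the variances.
    - By differentiation the density of Y satisfies fY x <= 2 lambda K|x|
      (density_le_smooth): the information - ln (fY / lambda) at Y is at least
      - ln (2 K|Y|). As the tail of |Y| evaluated at |Y| is uniform, the latter has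
      the law of lambda X (log_tail_law), which is the same information for X. Renyi
      and Tsallis entropies are monotone functions of the mean of
      exp ((1 - alpha) I), and Shannon's is that of the information I up to a
      constant, so all of them are compared at once.
    - In a case of equality |Y| has the law of X: for the variance by equality in
      the tail formula, for the entropies because fY takes only the values 0 and
      2 lambda K|x| (same_law_of_extremal_density). Then E|Y| = E X = - E Y forces
      Y = - |Y| almost surely, and Y has the law of - X (same_law_opp_of_abs).

    A geometric variable has on the integers the tail of an exponential variable of
    rate - ln (1 - p), so the same identities hold for integer arguments. The mass
    D n of Y outside of [1 - n, n] is that of S outside of [- n, n - 1]; it starts at
    1 and satisfies q D n <= D (n + 1) with q = 1 - p (remaining_hazard). The
    entropies are sums of phi over the masses of Y. For a concave phi with
    phi 0 = 0, merging the masses at n + 1 and - n decreases the sum, and the merged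
    masses are the decrements D n - D (n + 1). The sum of phi over the decrements of
    a sequence with this hazard bound is least for D n = q^n: if Phi m is the sum
    for the sequence m q^n, then phi (m - m') + Phi m' >= Phi m whenever
    q m <= m' < m, strictly unless m' = q m, and the differences telescope
    (value_function_step, value_function_limit). The sequence q^n is that of X. For
    alpha > 1 the argument applies to - t^alpha. *)

(** * Laws and tails of random variables *)

Section tails.
Context d (T : measurableType d) (R : realType) (P : probability T R).
Implicit Types (X Y Z : {RV P >-> R}) (f : T -> R) (x y r : R).

Definition toRV f (mf : measurable_fun [set: T] f) : {RV P >-> R} :=
  HB.pack f (isMeasurableFun.Build _ _ _ _ f mf).

Definition tail Z r : R := fine (P [set w | r < Z w]).

Lemma preimage_gt f r : f @^-1` `]r, +oo[ = [set w | r < f w].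
Proof. by apply/seteqP; split => w /=; rewrite in_itv/= andbT. Qed.

Lemma measurable_gt Z r : measurable [set w | r < Z w].
Proof. by rewrite -preimage_gt; exact: measurable_sfunP. Qed.

Lemma measurable_le Z r : measurable [set w | Z w <= r].
Proof.
have -> : [set w | Z w <= r] = ~` [set w | r < Z w].
  by apply/seteqP; split => w /=; rewrite leNgt => /negP.
exact/measurableC/measurable_gt.
Qed.

Lemma tailE Z r : (tail Z r)%:E = P [set w | r < Z w].
Proof. by rewrite /tail fineK// fin_num_measure//; exact: measurable_gt. Qed.

Lemma tail_ccdf Z r : (tail Z r)%:E = ccdf Z r.
Proof. by rewrite tailE /ccdf /distribution/= /pushforward preimage_gt. Qed.

Lemma tail_ge0 Z r : 0 <= tail Z r.
Proof. by rewrite -lee_fin tailE. Qed.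

Lemma tail_le1 Z r : tail Z r <= 1.
Proof. by rewrite -lee_fin tailE probability_le1//; exact: measurable_gt. Qed.

Lemma tail_le Z x y : x <= y -> tail Z y <= tail Z x.
Proof. by move=> xy; rewrite -lee_fin !tail_ccdf ccdf_nonincreasing. Qed.

Lemma cvg_tail_right Z r : tail Z x @[x --> r^'+] --> tail Z r.
Proof.
apply: fine_cvg; rewrite -/(tail Z r) tail_ccdf.
rewrite (_ : (fun x => _) = ccdf Z).
  exact: ccdf_right_continuous.
by apply/funext => x; rewrite -tailE tail_ccdf.
Qed.

Lemma cvg_tail_pinfty Z : tail Z x @[x --> +oo] --> (0:R).
Proof.
apply: fine_cvg.
rewrite (_ : (fun x => _) = ccdf Z).
  exact: cvg_ccdfy0.
by apply/funext => x; rewrite -tailE tail_ccdf.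
Qed.

Lemma prob_le Z r : P [set w | Z w <= r] = (1 - tail Z r)%:E.
Proof.
have -> : [set w | Z w <= r] = ~` [set w | r < Z w].
  by apply/seteqP; split => w /=; rewrite leNgt => /negP.
by rewrite probability_setC ?EFinB ?tailE//; exact: measurable_gt.
Qed.

Lemma prob_itvoc Z x y : x <= y ->
  distribution P Z `]x, y]%classic = (tail Z x - tail Z y)%:E.
Proof.
move=> xy; rewrite /distribution/= /pushforward.
have -> : Z @^-1` `]x, y]%classic =
    [set w | x < Z w] `\` [set w | y < Z w].
  apply/seteqP; split => w /=; rewrite in_itv/=.
    by move=> /andP[-> Zy]; split => //; apply/negP; rewrite -leNgt.
  by move=> [-> /negP]; rewrite -leNgt.
rewrite measureD; [|exact: measurable_gt|exact: measurable_gt|]; last first.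
  by rewrite ltey_eq fin_num_measure//; exact: measurable_gt.
rewrite setIidr => [|w /=]; last exact: le_lt_trans.
by rewrite EFinB !tailE.
Qed.

Lemma tail_same_law Y Z : same_law P Y Z -> tail Y = tail Z.
Proof.
move=> YZ; apply/funext => r.
by rewrite /tail -2!preimage_gt YZ.
Qed.

(** The tail gives the mass of every half-open interval, and these intervals form
    a pi-system that generates the Borel sets. *)
Lemma same_law_tail Y Z : (forall r, tail Y r = tail Z r) -> same_law P Y Z.
Proof.
move=> YZ A mA.
rewrite -/(pushforward P Y A) -/(pushforward P Z A).
apply: (@measure_unique _ _ _ (@ocitv R)
  (fun n => `](- n%:R), n%:R]%classic) _ _ _ _ (distribution P Y)
  (distribution P Z)) => //.
- exact: ocitvI.
- by move=> i; exact: is_ocitv.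
- rewrite -subTset => x _ /=.
  exists (Num.truncn `|x|).+1 => //=; rewrite in_itv/=.
  have := truncnS_gt `|x|; rewrite ltr_norml => /andP[-> /ltW ->//].
- move=> _ [[a b] _ <-] /=.
  have [ab|ba] := leP a b; first by rewrite !prob_itvoc// !YZ.
  by rewrite set_itv_ge ?bnd_simp -?leNgt ?ltW// !measure0.
- move=> k /=; rewrite ltey_eq; apply/orP; left.
  by rewrite fin_num_measure//; exact: is_ocitv.
Qed.

(** If F r < G r, then right continuity of G and monotonicity of F keep F below
    G on an interval to the right of r, which is not negligible. *)
Lemma ae_eq_nonincreasing (F G : R -> R) (r : R) :
  (forall x y, x <= y -> F y <= F x) -> (forall x y, x <= y -> G y <= G x) ->
  F x @[x --> r^'+] --> F r -> G x @[x --> r^'+] --> G r ->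
  (@lebesgue_measure R).-negligible [set x | r < x /\ F x != G x] ->
  F r = G r.
Proof.
move=> Fle Gle.
wlog FG : F G Fle Gle / F r < G r.
  move=> W cF cG FGN; have [||//] := ltgtP (F r) (G r).
    by move=> FG; apply: W.
  move=> GF; apply/esym; apply: W => //.
  by apply: negligibleS FGN => x /=; rewrite eq_sym.
move=> _ cG FGN; exfalso.
have /cvgr_gt/(_ _ FG)[e/= e0 He] := cG.
have N0 : (@lebesgue_measure R).-negligible `]r, (r + e)[%classic.
  apply: negligibleS FGN => x /=; rewrite in_itv/= => /andP[rx xe].
  split => //; rewrite lt_eqF// (le_lt_trans (Fle _ _ (ltW rx)))//.
  apply: He => //=; rewrite distrC ger0_norm; last by rewrite subr_ge0 ltW.
  by rewrite ltrBlDl.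
have : lebesgue_measure (`]r, (r + e)[%classic : set R) = 0%E.
  by apply/negligibleP => //; exact: measurable_itv.
rewrite lebesgue_measure_itv/= lte_fin ltrDl e0 -EFinD => -[].
by rewrite addrAC subrr add0r => e00; rewrite e00 ltxx in e0.
Qed.

End tails.

(** * Comparing expectations *)

Section integral_comparison.
Context d (T : measurableType d) (R : realType)
  (mu : {measure set T -> \bar R}).
Implicit Types f g : T -> R.
Local Open Scope ereal_scope.

(** All equality cases rest on this lemma: max f g has the same integral as g,
    so that the nonnegative function max f g - f has integral zero. *)
Lemma ae_eq_of_integral_le f g :
  measurable_fun [set: T] f -> measurable_fun [set: T] g ->
  (forall x, 0 <= f x)%R -> {ae mu, forall x, (f x <= g x)%R} ->
  \int[mu]_x (f x)%:E < +oo -> \int[mu]_x (g x)%:E <= \int[mu]_x (f x)%:E ->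
  {ae mu, forall x, f x = g x}.
Proof.
move=> mf mg f0 fg foo gf.
pose h x := Num.max (g x - f x)%R 0%R.
have mh : measurable_fun [set: T] h.
  by apply: measurable_maxr => //; exact: measurable_funB.
have h0 x : (0 <= h x)%R by rewrite /h le_max lexx orbT.
have gE : ae_eq mu setT (fun x => (Num.max (f x) (g x))%:E)
                        (fun x => (g x)%:E).
  by apply: filterS fg => x fgx _; rewrite max_r.
have split_int : \int[mu]_x (Num.max (f x) (g x))%:E =
    \int[mu]_x (f x)%:E + \int[mu]_x (h x)%:E.
  rewrite -ge0_integralD//=.
  - apply: eq_integral => x _; rewrite -EFinD; congr EFin.
    by rewrite /h addr_maxr addrC subrK addr0 maxC.
  - by move=> x _; rewrite lee_fin.
  - exact/measurable_EFinP.
  - by move=> x _; rewrite lee_fin.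
  - exact/measurable_EFinP.
have le1 : \int[mu]_x (Num.max (f x) (g x))%:E <= \int[mu]_x (f x)%:E.
  rewrite (ae_eq_integral (fun x => (g x)%:E))//.
    by apply/measurable_EFinP; exact: measurable_maxr.
  exact/measurable_EFinP.
have hE0 : \int[mu]_x (h x)%:E = 0.
  apply/eqP; rewrite eq_le integral_ge0 ?andbT; last first.
    by move=> x _; rewrite lee_fin.
  move: le1; rewrite split_int -[leRHS]adde0 leeD2lE//.
  by rewrite ge0_fin_numE//; apply: integral_ge0 => x _; rewrite lee_fin.
have : \int[mu]_x `|(h x)%:E| = 0.
  by rewrite -[RHS]hE0; apply: eq_integral => x _; rewrite gee0_abs ?lee_fin.
move/ae_eq_integral_abs => /(_ measurableT).
move=> /(_ ((measurable_EFinP _ _).2 mh)) hae.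
apply: filterS2 fg hae => x fgx /(_ I) [] hx; apply/eqP.
rewrite eq_le fgx/=; move: hx; rewrite /h => /eqP.
by rewrite eq_le ge_max lexx subr_le0 andbT => /andP[].
Qed.

End integral_comparison.

Section tail_formula.
Context d (T : measurableType d) (R : realType) (P : probability T R).
Implicit Types (X Y Z : {RV P >-> R}) (f : T -> R) (x y r : R).
Local Open Scope ereal_scope.

Lemma measurable_tail Z : measurable_fun [set: R] (tail Z).
Proof.
have -> : tail Z = fine \o ccdf Z by apply/funext => r; rewrite /= -tail_ccdf.
by apply: measurableT_comp => //; exact: ccdf_measurable.
Qed.

Lemma ge0_integral_tail Z : (forall w, 0 <= Z w)%R ->
  \int[P]_w (Z w)%:E =
  \int[@lebesgue_measure R]_(r in `[0%R, +oo[) (tail Z r)%:E.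
Proof.
move=> Z0; rewrite -expectation_def ge0_expectation_ccdf//.
by apply: eq_integral => r _; rewrite tail_ccdf.
Qed.

End tail_formula.

Lemma le_integral_tail d d' (T : measurableType d) (T' : measurableType d')
    (R : realType) (P : probability T R) (P' : probability T' R)
    (Y : {RV P >-> R}) (Z : {RV P' >-> R}) :
  (forall w, 0 <= Z w) -> (forall w, 0 <= Y w) ->
  (forall r, 0 <= r -> tail Z r <= tail Y r) ->
  (\int[P']_w (Z w)%:E <= \int[P]_w (Y w)%:E)%E.
Proof.
move=> Z0 Y0 ZY; rewrite !ge0_integral_tail//.
apply: ge0_le_integral => //.
- by move=> r _; rewrite lee_fin tail_ge0.
- by apply/measurable_EFinP/measurable_funTS; exact: measurable_tail.
- by apply/measurable_EFinP/measurable_funTS; exact: measurable_tail.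
- by move=> r; rewrite /= in_itv/= andbT lee_fin => /ZY.
Qed.

Section stochastic_order.
Context d (T : measurableType d) (R : realType) (P : probability T R).
Implicit Types (X Y Z : {RV P >-> R}) (f : T -> R) (x y r : R).
Local Open Scope ereal_scope.

(** The mean of a nonnegative variable is the integral of its tail, so that the
    ordered tails agree almost everywhere; right continuity does the rest. *)
Lemma tail_eq_of_integral_eq Y Z :
  (forall w, 0 <= Z w)%R -> (forall w, 0 <= Y w)%R ->
  (forall r, 0 <= r -> tail Z r <= tail Y r)%R ->
  \int[P]_w (Z w)%:E < +oo -> \int[P]_w (Y w)%:E = \int[P]_w (Z w)%:E ->
  (forall r, 0 <= r -> tail Z r = tail Y r)%R.
Proof.
move=> Z0 Y0 ZY + + s s0; rewrite !ge0_integral_tail// => Zoo YZ.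
pose cut (V : {RV P >-> R}) := tail V \_ `[0%R, +oo[.
have mcut V : measurable_fun setT (cut V).
  apply/(measurable_restrictT _ _).1 => //; apply: measurable_funTS; exact: measurable_tail.
have cut_int : forall U : {RV P >-> R}, \int[@lebesgue_measure R]_r (cut U r)%:E =
    \int[@lebesgue_measure R]_(r in `[0%R, +oo[) (tail U r)%:E.
  move=> U.
  rewrite [RHS]integral_mkcond; apply: eq_integral => r _.
  by rewrite /cut !patchE; case: ifP.
have cut0 V r : (0 <= cut V r)%R.
  by rewrite /cut patchE; case: ifP => // _; exact: tail_ge0.
have : {ae @lebesgue_measure R, forall r, cut Z r = cut Y r}.
  apply: ae_eq_of_integral_le => //; rewrite ?cut_int ?YZ//.
  - exact: mcut.
  - exact: mcut.
  apply: aeW => r /=; rewrite /cut !patchE; case: ifP => //.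
  by rewrite inE/= in_itv/= andbT => /ZY.
move=> N; apply: (@ae_eq_nonincreasing R (tail Z) (tail Y) s).
- by move=> ? ?; exact: tail_le.
- by move=> ? ?; exact: tail_le.
- exact: cvg_tail_right.
- exact: cvg_tail_right.
apply: negligibleS N => r /= [sr /eqP rN]; apply: contra_not rN.
by rewrite /cut !patchE mem_set//= in_itv/= andbT (le_trans s0 (ltW sr)).
Qed.

End stochastic_order.

(** * Symmetrizers of a nonnegative variable *)

Section same_law.
Context d (T : measurableType d) (R : realType) (P : probability T R).
Implicit Types (X Y Z : {RV P >-> R}) (f : T -> R) (x y r : R).

Lemma same_law_trans f g h :
  same_law P f g -> same_law P g h -> same_law P f h.
Proof. by move=> fg gh A mA; rewrite fg// gh. Qed.

Lemma same_law_comp f g (h : R -> R) : measurable_fun [set: R] h ->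
  same_law P f g -> same_law P (h \o f) (h \o g).
Proof.
move=> mh fg A mA; apply: (fg (h @^-1` A)).
by rewrite -[X in measurable X]setTI; exact: mh.
Qed.

Lemma same_law_ae f g :
  measurable_fun [set: T] f -> measurable_fun [set: T] g ->
  {ae P, forall w, f w = g w} -> same_law P f g.
Proof.
move=> mf mg fg A mA.
have m1 : measurable (f @^-1` A) by rewrite -[X in measurable X]setTI; exact: mf.
have m2 : measurable (g @^-1` A) by rewrite -[X in measurable X]setTI; exact: mg.
rewrite -[LHS]mul1e -[RHS]mul1e -!integral_cst//.
rewrite [LHS]integral_mkcond [RHS]integral_mkcond.
apply: ae_eq_integral => //.
- exact/(measurable_restrictT _ _).1.
- exact/(measurable_restrictT _ _).1.
- apply: filterS fg => w fgw _; rewrite !patchE.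
  have -> // : (w \in f @^-1` A) = (w \in g @^-1` A).
  by apply/idP/idP; rewrite !inE/= fgw.
Qed.

Lemma ge0_same_law_integral f g (h : R -> \bar R) :
  measurable_fun [set: T] f -> measurable_fun [set: T] g ->
  measurable_fun [set: R] h -> (forall x, 0 <= h x)%E ->
  same_law P f g -> (\int[P]_w h (f w) = \int[P]_w h (g w))%E.
Proof.
move=> mf mg mh h0 fg.
rewrite -(@ge0_integral_distribution _ _ _ _ _ P (toRV P mf))//.
rewrite -(@ge0_integral_distribution _ _ _ _ _ P (toRV P mg))//.
by apply: eq_measure_integral => A mA _; exact: fg.
Qed.

End same_law.

Section moments.
Context d (T : measurableType d) (R : realType) (P : probability T R).
Implicit Types (X Y Z : {RV P >-> R}).
Local Open Scope ereal_scope.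

Lemma integrable_of_sqr Z :
  \int[P]_w (Z w ^+ 2)%:E < +oo -> P.-integrable [set: T] (EFin \o Z).
Proof.
move=> Zoo; apply/integrableP; split; first exact/measurable_EFinP.
apply: (@le_lt_trans _ _ (\int[P]_w (1 + Z w ^+ 2)%:E)).
  apply: ge0_le_integral => //=.
  - by apply/measurable_EFinP; exact: measurableT_comp.
  - apply/measurable_EFinP; apply: measurable_funD => //.
    exact: measurable_funX.
  - move=> w _; rewrite lee_fin -real_normK ?num_real//.
    by have := sqr_ge0 (`|Z w| - 1)%R; nra.
under eq_integral do rewrite EFinD.
rewrite ge0_integralD//=; last 2 first.
  by move=> w _; rewrite lee_fin sqr_ge0.
  by apply/measurable_EFinP; exact: measurable_funX.
rewrite lte_add_pinfty// integral_cst//= probability_setT mul1e.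
exact: ltry.
Qed.

Lemma Lfun2_of_sqr Z : \int[P]_w (Z w ^+ 2)%:E < +oo ->
  (Z : T -> R) \in Lfun P 2%:E.
Proof.
move=> Zoo; rewrite inE; apply/andP; split; rewrite inE//=.
rewrite /finite_norm unlock /Lnorm.
under eq_integral => w _.
  rewrite /= powR_mulrn// real_normK ?num_real//; over.
apply: poweR_lty; exact: Zoo.
Qed.

(** Z^2 <= 2 (Z - c)^2 + 2 c^2. *)
Lemma variance_finite_sqr Z : 'V_P[Z] < +oo -> \int[P]_w (Z w ^+ 2)%:E < +oo.
Proof.
rewrite /variance unlock; set c := fine _.
rewrite unlock => Voo.
apply: (@le_lt_trans _ _
  (\int[P]_w (2%:E * ((Z w - c) * (Z w - c))%:E + (2 * c ^+ 2)%:E))).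
  apply: ge0_le_integral => //=.
  - by move=> w _; rewrite lee_fin sqr_ge0.
  - by apply/measurable_EFinP; exact: measurable_funX.
  - apply: emeasurable_funD => //; apply: measurable_funeM.
    by apply/measurable_EFinP; apply: measurable_funM; exact: measurable_funB.
  - move=> w _; rewrite -EFinM -EFinD lee_fin.
    by have := sqr_ge0 (Z w - 2 * c)%R; nra.
have m2 : measurable_fun setT (fun w => ((Z w - c) * (Z w - c))%:E).
  by apply/measurable_EFinP; apply: measurable_funM; exact: measurable_funB.
rewrite ge0_integralD//=; last 3 first.
- by move=> w _; rewrite -EFinM lee_fin mulr_ge0// -expr2 sqr_ge0.
- exact: measurable_funeM.
- by move=> w _; rewrite lee_fin mulr_ge0// sqr_ge0.
rewrite ge0_integralZl//=; last first.
  by move=> w _; rewrite lee_fin -expr2 sqr_ge0.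
rewrite integral_cst//= probability_setT mule1 lte_add_pinfty ?ltry//.
by rewrite lte_mul_pinfty.
Qed.

End moments.

Section absolute_value.
Context d (T : measurableType d) (R : realType) (P : probability T R).
Implicit Types Z : {RV P >-> R}.

Lemma measurable_norm (Z : {RV P >-> R}) :
  measurable_fun [set: T] (fun w => `|Z w|%R).
Proof. exact: measurableT_comp. Qed.

Definition absRV (Z : {RV P >-> R}) : {RV P >-> R} := toRV P (measurable_norm Z).

Lemma measurable_sqr (Z : {RV P >-> R}) :
  measurable_fun [set: T] (fun w => Z w ^+ 2)%R.
Proof. exact: measurable_funX. Qed.

Definition sqrRV Z : {RV P >-> R} := toRV P (measurable_sqr Z).

Lemma tail_sqr Z r : (0 <= r -> tail (sqrRV Z) r = tail (absRV Z) (Num.sqrt r))%R.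
Proof.
move=> r0; congr (fine (P _)); apply/seteqP; split => w /=.
  move=> rZ; rewrite -(@ltr_pXn2r _ 2) ?nnegrE ?sqrtr_ge0//.
  by rewrite sqr_sqrtr// real_normK// num_real.
move=> rZ; rewrite -(@real_normK _ (Z w)) ?num_real//.
by rewrite -[ltLHS]sqr_sqrtr// ltr_pXn2r// ?nnegrE ?sqrtr_ge0.
Qed.

End absolute_value.

Section symmetrizer.
Context d (T : measurableType d) (R : realType) (P : probability T R).
Variables X Y : {RV P >-> R}.
Hypothesis symS : same_law P (X \+ Y) (\- (X \+ Y)).
Local Open Scope ereal_scope.

(** A symmetric integrable variable has mean zero. *)
Lemma symmetric_mean0 :
  P.-integrable [set: T] (EFin \o X) -> P.-integrable [set: T] (EFin \o Y) ->
  \int[P]_w (X w)%:E + \int[P]_w (Y w)%:E = 0.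
Proof.
move=> iX iY.
have iS : P.-integrable [set: T] (EFin \o (X \+ Y)%R).
  rewrite (_ : _ \o _ = (EFin \o X) \+ (EFin \o Y))//.
  exact: integrableD.
rewrite -(@integralD _ _ _ P setT _ (EFin \o X) (EFin \o Y))//.
have mS : measurable_fun [set: T] (X \+ Y)%R by exact: measurable_funD.
have mN : measurable_fun [set: T] (\- (X \+ Y))%R by exact: measurableT_comp.
set S := \int[P]_w _.
have Sfin : S \is a fin_num.
  have /(integrable_fin_num measurableT) := iS.
  by rewrite /S.
have SN : S = - S.
  rewrite {2}/S -integralN//; last exact: integrable_add_def.
  transitivity (\int[distribution P (toRV P mS)]_y y%:E).
    rewrite integral_distribution//.
  transitivity (\int[distribution P (toRV P mN)]_y y%:E).
    by apply: eq_measure_integral => A mA _; exact: symS.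
  rewrite integral_distribution//=.
  by rewrite (_ : EFin \o _ = -%E \o (EFin \o (X \+ Y)%R))//; exact: integrableN.
move: Sfin SN; case: S => // s _ [] sN; congr EFin; lra.
Qed.

Hypothesis X0 : {ae P, forall w, (0 <= X w)%R}.
Hypothesis X2 : \int[P]_w (X w ^+ 2)%:E < +oo.

Let iX : P.-integrable [set: T] (EFin \o X).
Proof. exact: integrable_of_sqr. Qed.

Let absX : {ae P, forall w, absRV X w = X w}.
Proof. by apply: filterS X0 => w Xw; rewrite /= ger0_norm. Qed.

(** If |Y| has the law of X, then E|Y| = E X = - E Y, so that Y = - |Y| almost
    surely. *)
Lemma same_law_opp_of_abs :
  (forall r, 0 <= r -> tail (absRV Y) r = tail (absRV X) r)%R ->
  same_law P Y (\- X)%R.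
Proof.
move=> YX.
have absYX : same_law P (absRV Y) (absRV X).
  apply: same_law_tail => r; have [/YX//|r0] := leP 0%R r.
  have E (Z : {RV P >-> R}) : [set w | (r < absRV Z w)%R] = setT.
    by rewrite -subTset => w _ /=; exact: lt_le_trans r0 _.
  by rewrite /tail !E.
have mE : measurable_fun [set: R] (fun x => `|x|%:E).
  by apply/measurable_EFinP; exact: normr_measurable.
have intE : \int[P]_w `|Y w|%:E = \int[P]_w (X w)%:E.
  transitivity (\int[P]_w `|absRV Y w|%:E).
    by apply: eq_integral => w _ /=; rewrite normr_id.
  rewrite (ge0_same_law_integral _ _ mE _ absYX)//.
  apply: ae_eq_integral => //.
    by apply: measurableT_comp => //; exact: (measurable_norm (absRV X)).
    exact/measurable_EFinP.
  by apply: filterS X0 => w Xw _ /=; rewrite normr_id ger0_norm.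
have iY : P.-integrable [set: T] (EFin \o Y).
  apply/integrableP; split; first exact/measurable_EFinP.
  rewrite (_ : \int[P]_w _ = \int[P]_w `|Y w|%:E)// intE.
  by rewrite ltey_eq (integrable_fin_num measurableT).
have absNY : {ae P, forall w, 0%R = (`|Y w| + Y w)%R}.
  apply: ae_eq_of_integral_le => //.
  - by apply: measurable_funD => //; exact: (measurable_norm Y).
  - by apply: aeW => w; rewrite -lerBlDr sub0r -normrN ler_norm.
  - by rewrite integral0 ltry.
  rewrite integral0.
  under eq_integral do rewrite EFinD.
  rewrite integralD//; last exact: integrable_abse iY.
  by rewrite intE symmetric_mean0.
have mopp : measurable_fun [set: R] (fun x : R => - x)%R by exact: oppr_measurable.
apply: (@same_law_trans _ _ _ _ _ (-%R \o absRV Y)).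
  apply: same_law_ae => //.
    exact: measurableT_comp.
  by apply: filterS absNY => w /= h; lra.
apply: (same_law_trans (same_law_comp mopp absYX)).
apply: same_law_ae.
- exact: (measurableT_comp mopp).
- exact: (measurableT_comp mopp).
by apply: filterS absX => w /= ->.
Qed.

Hypothesis YX : forall r, (0 <= r -> tail (absRV X) r <= tail (absRV Y) r)%R.

Let sqr_tails r : (0 <= r -> tail (sqrRV X) r <= tail (sqrRV Y) r)%R.
Proof. by move=> r0; rewrite !tail_sqr// YX// sqrtr_ge0. Qed.

Let sqr_le : \int[P]_w (X w ^+ 2)%:E <= \int[P]_w (Y w ^+ 2)%:E.
Proof.
by apply: (le_integral_tail (Y := sqrRV Y) (Z := sqrRV X)) => // w; exact: sqr_ge0.
Qed.

Let LX : (X : T -> R) \in Lfun P 2%:E. Proof. exact: Lfun2_of_sqr. Qed.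

Let variance_sqr : \int[P]_w (Y w ^+ 2)%:E < +oo ->
  exists c : R, 'V_P[X] = \int[P]_w (X w ^+ 2)%:E - c%:E /\
    'V_P[Y] = \int[P]_w (Y w ^+ 2)%:E - c%:E.
Proof.
move=> Y2; have iY := integrable_of_sqr Y2.
exists (fine ('E_P[X] ^+ 2)).
have Xfin : 'E_P[X] \is a fin_num.
  by rewrite expectation_def; exact: integrable_fin_num.
have YE : 'E_P[Y] = - 'E_P[X].
  move: Xfin; rewrite !expectation_def; have := symmetric_mean0 iX iY.
  case: (\int[P]_w (X w)%:E) => // x; case: (\int[P]_w (Y w)%:E) => //= y [] h _.
  by congr EFin; lra.
rewrite !varianceE//; last exact: Lfun2_of_sqr.
rewrite fineK; last by rewrite fin_numX.
have -> : 'E_P[Y] ^+ 2 = 'E_P[X] ^+ 2 by rewrite YE !expe2 muleNN.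
split; first by congr (_ - _); rewrite expectation_def.
by congr (_ - _); rewrite expectation_def.
Qed.

(** E Y^2 dominates E X^2 by the tail formula, while E Y = - E X by symmetry, so
    that both variances subtract the same square. *)
Lemma variance_le_of_abs : 'V_P[X] <= 'V_P[Y].
Proof.
have [Y2|] := ltP (\int[P]_w (Y w ^+ 2)%:E) +oo.
  have [c [-> ->]] := variance_sqr Y2.
  by rewrite leeD2r.
rewrite leye_eq => /eqP Y2; rewrite leNgt; apply/negP => VY.
have /variance_finite_sqr : 'V_P[Y] < +oo by rewrite (lt_le_trans VY)// leey.
by rewrite Y2 ltxx.
Qed.

Lemma variance_eq_of_abs : 'V_P[Y] = 'V_P[X] <-> same_law P Y (\- X)%R.
Proof.
split=> [VE|law].
- have Y2 : \int[P]_w (Y w ^+ 2)%:E < +oo.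
    by apply: variance_finite_sqr; rewrite VE ltey_eq variance_fin_num.
  have [c [VX VY]] := variance_sqr Y2.
  have sqE : \int[P]_w (Y w ^+ 2)%:E = \int[P]_w (X w ^+ 2)%:E.
    move: VE; rewrite VX VY => /(congr1 (fun x => x + c%:E)).
    by rewrite !subeK.
  apply: same_law_opp_of_abs => r r0.
  have r20 : (0 <= r ^+ 2)%R by exact: sqr_ge0.
  have := @tail_eq_of_integral_eq _ _ _ P (sqrRV Y) (sqrRV X).
  move=> /(_ _ _ sqr_tails X2 sqE (r ^+ 2)%R r20).
  rewrite !tail_sqr// sqrtr_sqr ger0_norm// => -> // w; exact: sqr_ge0.
- have mN : measurable_fun [set: T] (\- X)%R by exact: measurableT_comp.
  have sqE : \int[P]_w (Y w ^+ 2)%:E = \int[P]_w (X w ^+ 2)%:E.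
    rewrite (ge0_same_law_integral (h := fun x => (x ^+ 2)%:E) _ mN _ _ law)//.
    + by apply: eq_integral => w _; rewrite sqrrN.
    + by apply/measurable_EFinP; exact: exprn_measurable.
    + by move=> x; rewrite lee_fin sqr_ge0.
  have Y2 : \int[P]_w (Y w ^+ 2)%:E < +oo by rewrite sqE.
  by have [c [-> ->]] := variance_sqr Y2; rewrite sqE.
Qed.

End symmetrizer.

(** * Adding an independent exponential variable *)

Section independent_sum.
Context d (T : measurableType d) (R : realType) (P : probability T R).
Variables X Y : {RV P >-> R}.
Hypothesis indXY : independent X Y.
Local Open Scope ereal_scope.

Let mYX : measurable_fun [set: T] (fun w => (Y w, X w)).
Proof. exact: measurable_fun_pair. Qed.

Let YX : {mfun T >-> (R * R)%type} :=
  HB.pack (fun w => (Y w, X w)) (isMeasurableFun.Build _ _ _ _ _ mYX).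

(** Fubini's theorem for the joint law of Y and X, a product measure. *)
Lemma independent_sum_gt x :
  P [set w | (x < X w + Y w)%R] = \int[P]_w (tail X (x - Y w))%:E.
Proof.
pose A := [set z : (R * R)%type | (x < z.2 + z.1)%R].
have mA : measurable A.
  have m2 : measurable_fun [set: (R * R)%type] (fun z => z.2 + z.1)%R.
    by apply: measurable_funD.
  rewrite (_ : A = (fun z : (R * R)%type => z.2 + z.1)%R @^-1` `]x, +oo[).
    by rewrite -[X in measurable X]setTI; exact: m2.
  by apply/seteqP; split => z /=; rewrite in_itv/= andbT.
rewrite (_ : [set w | _] = YX @^-1` A)//.
rewrite -[LHS]/(distribution P YX A).
rewrite -(@product_measure_unique _ _ _ _ _ (distribution P Y) (distribution P X)
  (distribution P YX))//; last first.
  move=> B C mB mC; rewrite /distribution/= /pushforward.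
  rewrite [RHS]muleC -indXY// setIC.
  by congr (P _).
rewrite /product_measure1.
rewrite ge0_integral_distribution//; last exact: measurable_fun_xsection.
apply: eq_integral => w _ /=.
rewrite tailE /distribution /= /pushforward; congr (P _).
by apply/seteqP; split => v /=; rewrite /xsection/= inE/= ltrBlDr.
Qed.

End independent_sum.

Section exponential_smoothing.
Context d (T : measurableType d) (R : realType) (P : probability T R).
Variables (Y : {RV P >-> R}) (lambda : R).
Hypothesis lambda0 : 0 < lambda.
Implicit Types x t h : R.

Definition exp_tail t : R := Num.min 1 (expR (- (lambda * t))).

Lemma measurable_exp_tail : measurable_fun [set: R] exp_tail.
Proof.
apply: measurable_minr => //; apply: measurableT_comp => //.
by apply: measurableT_comp => //; exact: mulrl_measurable.
Qed.

Lemma exp_tail_le0 t : t <= 0 -> exp_tail t = 1.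
Proof.
move=> t0; rewrite /exp_tail min_l// -[leLHS]expR0 ler_expR oppr_ge0.
by rewrite pmulr_rle0.
Qed.

Lemma exp_tail_ge0 t : 0 <= t -> exp_tail t = expR (- (lambda * t)).
Proof.
move=> t0; rewrite /exp_tail min_r// -[leRHS]expR0 ler_expR oppr_le0.
by rewrite pmulr_rge0.
Qed.

Lemma exp_tail_gt0 t : 0 < exp_tail t.
Proof. by rewrite lt_min ltr01 expR_gt0. Qed.

Lemma exp_tail_le1 t : exp_tail t <= 1.
Proof. by rewrite ge_min lexx. Qed.

Lemma exp_tail_le t h : 0 <= h -> exp_tail (t + h) <= exp_tail t.
Proof.
move=> h0; rewrite /exp_tail le_min !ge_min lexx/= ler_expR lerN2 ler_pM2l//.
by rewrite lerDl h0 orbT.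
Qed.

Lemma exp_tail_hazard t h : 0 <= h ->
  expR (- (lambda * h)) * exp_tail t <= exp_tail (t + h).
Proof.
move=> h0; rewrite {2}/exp_tail le_min; apply/andP; split.
  rewrite mulr_ile1 ?expR_ge0 ?exp_tail_le1 ?(ltW (exp_tail_gt0 _))//.
  by rewrite -[leRHS]expR0 ler_expR oppr_le0 mulr_ge0// ltW.
rewrite mulrDr opprD expRD [leRHS]mulrC ler_pM2l ?expR_gt0//.
by rewrite /exp_tail ge_min lexx orbT.
Qed.

(** The integrand identity behind the smoothing: to the right of the atom at
    zero of the point mass, exp_tail decays at the exact rate lambda. *)
Lemma exp_tail_decay_ge t h : 0 <= h ->
  (1 - expR (- (lambda * h))) * (exp_tail t - (t < 0)%R%:R) <=
  exp_tail t - exp_tail (t + h).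
Proof.
move=> h0; have [t0|t0] := ltP t 0.
  by rewrite exp_tail_le0 ?(ltW t0)// subrr mulr0 subr_ge0 exp_tail_le1.
rewrite subr0 !exp_tail_ge0// ?addr_ge0// mulrDr opprD expRD.
lra.
Qed.

Lemma exp_tail_decay_le t h : 0 <= h ->
  exp_tail t - exp_tail (t + h) <=
  (1 - expR (- (lambda * h))) * (exp_tail t - (t + h < 0)%R%:R).
Proof.
move=> h0; have [th|th] := ltP (t + h) 0.
  rewrite !exp_tail_le0 ?(ltW th)//; last first.
    by rewrite (le_trans _ (ltW th))// lerDl.
  by rewrite subrr mulr0.
rewrite subr0; have [t0|t0] := ltP t 0.
  rewrite exp_tail_le0 ?(ltW t0)// mulr1 lerD2l lerN2 exp_tail_ge0// ler_expR.
  by rewrite lerN2 ler_pM2l// gerDr ltW.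
rewrite !exp_tail_ge0// ?addr_ge0// mulrDr opprD expRD.
lra.
Qed.

(** For X exponential of rate lambda and independent of Y, this is the
    probability of X + Y > x. *)
Definition smooth x : R := (\int[P]_w exp_tail (x - Y w))%R.

Lemma integrable_bounded01 (f : T -> R) : measurable_fun [set: T] f ->
  (forall w, 0 <= f w <= 1) -> P.-integrable [set: T] (EFin \o f).
Proof.
move=> mf f01; apply: (@le_integrable _ _ _ P _ measurableT _ (cst 1%E)) => //.
- exact/measurable_EFinP.
- by move=> w _ /=; rewrite lee_fin normr1 ger0_norm; case/andP: (f01 w).
- exact: finite_measure_integrable_cst.
Qed.

Lemma integrable_scale c (f : T -> R) :
  P.-integrable [set: T] (EFin \o f) ->
  P.-integrable [set: T] (EFin \o (fun w => c * f w)).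
Proof.
move=> fi; rewrite (_ : _ \o _ = (fun w => c%:E * (EFin \o f) w)%E)//.
exact: integrableZl.
Qed.

Lemma measurable_shift x : measurable_fun [set: T] (fun w => exp_tail (x - Y w)).
Proof.
apply: (measurableT_comp measurable_exp_tail).
exact: measurable_funB.
Qed.

Lemma integrable_exp_tail x :
  P.-integrable [set: T] (EFin \o (fun w => exp_tail (x - Y w))).
Proof.
apply: integrable_bounded01; first exact: measurable_shift.
by move=> w; rewrite exp_tail_le1 ltW// exp_tail_gt0.
Qed.

Lemma gt_indicatorE x w : (x < Y w)%R%:R = \1_[set v | x < Y v] w :> R.
Proof.
rewrite indicE; suff -> : (w \in [set v | x < Y v]) = (x < Y w) by [].
by apply/idP/idP; rewrite inE.
Qed.

Lemma measurable_gt_indicator x :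
  measurable_fun [set: T] (fun w => (x < Y w)%R%:R : R).
Proof.
rewrite (_ : (fun w => _) = \1_[set w | x < Y w]).
  by apply: measurable_indic; exact: measurable_gt.
by apply/funext => w; exact: gt_indicatorE.
Qed.

Lemma integrable_gt_indicator x :
  P.-integrable [set: T] (EFin \o (fun w => (x < Y w)%R%:R)).
Proof.
apply: integrable_bounded01; first exact: measurable_gt_indicator.
by move=> w; case: (_ < _); rewrite /= ?lexx ?ler01.
Qed.

Lemma tail_Rintegral x : tail Y x = (\int[P]_w (x < Y w)%R%:R)%R.
Proof.
rewrite /Rintegral /tail.
under eq_integral => w _.
  rewrite gt_indicatorE; over.
by rewrite integral_indic ?setIT//; exact: measurable_gt.
Qed.

Lemma smooth_le1 x : smooth x <= 1.
Proof.
rewrite -[leRHS](_ : (\int[P]_w (cst 1 w))%R = 1); last first.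
  rewrite Rintegral_cst// mul1r [X in fine X]probability_setT//.
apply: le_Rintegral => //; first exact: integrable_exp_tail.
- exact: finite_measure_integrable_cst.
- by move=> w _; exact: exp_tail_le1.
Qed.

Lemma smooth_ge0 x : 0 <= smooth x.
Proof. by apply: Rintegral_ge0 => w _; rewrite ltW// exp_tail_gt0. Qed.

Lemma smooth_le x y : x <= y -> smooth y <= smooth x.
Proof.
move=> xy; rewrite /smooth; apply: le_Rintegral => //; do ?exact: integrable_exp_tail.
move=> w _; have -> : y - Y w = x - Y w + (y - x) by ring.
by rewrite exp_tail_le// subr_ge0.
Qed.

(** Whatever the law of Y, the smoothed tail has a hazard rate of at most lambda,
    because exp_tail has. *)
Lemma smooth_hazard x h : 0 <= h ->
  expR (- (lambda * h)) * smooth x <= smooth (x + h).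
Proof.
move=> h0; rewrite /smooth -RintegralZl//; last exact: integrable_exp_tail.
apply: le_Rintegral => //; last 2 first.
  exact: integrable_exp_tail.
  by move=> w _; rewrite addrAC exp_tail_hazard.
by apply: integrable_scale; exact: integrable_exp_tail.
Qed.

Lemma integrable_excess x y : P.-integrable [set: T]
  (EFin \o (fun w => exp_tail (x - Y w) - (y < Y w)%R%:R)).
Proof.
rewrite (_ : _ \o _ = (EFin \o (fun w => exp_tail (x - Y w))) \-
  (EFin \o (fun w => (y < Y w)%R%:R)))%E//.
apply: integrableB => //; first exact: integrable_exp_tail.
exact: integrable_gt_indicator.
Qed.

Lemma smooth_sub_tail x y :
  smooth x - tail Y y = (\int[P]_w (exp_tail (x - Y w) - (y < Y w)%R%:R))%R.
Proof.
rewrite RintegralB// ?tail_Rintegral//; first exact: integrable_exp_tail.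
exact: integrable_gt_indicator.
Qed.

Lemma smooth_sub x y :
  smooth x - smooth y = (\int[P]_w (exp_tail (x - Y w) - exp_tail (y - Y w)))%R.
Proof. by rewrite RintegralB//; exact: integrable_exp_tail. Qed.

Lemma integrable_decrement x y : P.-integrable [set: T]
  (EFin \o (fun w => exp_tail (x - Y w) - exp_tail (y - Y w))).
Proof.
rewrite (_ : _ \o _ = (EFin \o (fun w => exp_tail (x - Y w))) \-
  (EFin \o (fun w => exp_tail (y - Y w))))%E//.
by apply: integrableB => //; exact: integrable_exp_tail.
Qed.

Lemma smooth_tail_le x : tail Y x <= smooth x.
Proof.
rewrite -subr_ge0 smooth_sub_tail; apply: Rintegral_ge0 => w _.
rewrite subr_ge0; have [xY|_] := ltP x (Y w); last exact/ltW/exp_tail_gt0.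
by rewrite exp_tail_le0// subr_le0 ltW.
Qed.

(** exp_tail is positive to the right of zero, where the indicator vanishes. *)
Lemma smooth_tail_lt x : tail Y x < 1 -> tail Y x < smooth x.
Proof.
move=> Yx; rewrite lt_neqAle smooth_tail_le andbT; apply/negP => /eqP E.
suff : tail Y x = 1 by move=> Yx1; rewrite Yx1 ltxx in Yx.
have E0 : ({ae P, forall w, 0 = exp_tail (x - Y w) - (x < Y w)%R%:R})%R.
  apply: ae_eq_of_integral_le => //.
  - apply: measurable_funB; first exact: measurable_shift.
    exact: measurable_gt_indicator.
  - apply: aeW => w.
    rewrite subr_ge0; have [xY|_] := ltP x (Y w); last exact/ltW/exp_tail_gt0.
    by rewrite exp_tail_le0// subr_le0 ltW.
  - by rewrite integral0 ltry.
  rewrite integral0.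
  have := smooth_sub_tail x x; rewrite E subrr /Rintegral => /esym.
  set I := (\int[_]_w _)%E => I0.
  suff : I \is a fin_num by move=> /fineK <-; rewrite I0.
  apply: (integrable_fin_num measurableT).
  exact: integrable_excess.
have : {ae P, forall w, x < Y w}.
  apply: filterS E0 => w /eqP; rewrite eq_sym.
  by case: ltP => //; rewrite subr0 gt_eqF// exp_tail_gt0.
move=> [N [mN N0 sub]]; apply/EFin_inj; rewrite tailE.
apply/eqP; rewrite eq_le probability_le1; last exact: measurable_gt.
rewrite andTb.
rewrite -[leLHS](_ : P (~` N) = 1%E); last by rewrite probability_setC// N0 sube0.
apply: le_measure; rewrite ?inE; [exact: measurableC|exact: measurable_gt|].
by move=> w Nw; apply: contrapT => /sub.
Qed.

(** Together with the next lemma: - K' = lambda (K - P (Y > x)) for the smoothed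
    tail K, as a pair of finite differences that needs no regularity of Y. *)
Lemma smooth_decay_ge x h : 0 <= h ->
  (1 - expR (- (lambda * h))) * (smooth x - tail Y x) <=
  smooth x - smooth (x + h).
Proof.
move=> h0; rewrite smooth_sub_tail smooth_sub -RintegralZl//; last first.
  exact: integrable_excess.
apply: le_Rintegral => //.
- by apply: integrable_scale; exact: integrable_excess.
- exact: integrable_decrement.
- by move=> w _; rewrite addrAC -[(x < Y w)%R]subr_lt0 exp_tail_decay_ge.
Qed.

Lemma smooth_decay_le x h : 0 <= h ->
  smooth x - smooth (x + h) <=
  (1 - expR (- (lambda * h))) * (smooth x - tail Y (x + h)).
Proof.
move=> h0; rewrite smooth_sub_tail smooth_sub -RintegralZl//; last first.
  exact: integrable_excess.
apply: le_Rintegral => //.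
- exact: integrable_decrement.
- by apply: integrable_scale; exact: integrable_excess.
- move=> w _; have -> : (x + h < Y w) = (x - Y w + h < 0).
    by rewrite addrAC subr_lt0.
  by rewrite [x + h - Y w]addrAC exp_tail_decay_le.
Qed.

End exponential_smoothing.

(** * Densities *)

Section reflection.
Context (R : realType).
Local Notation mu := (@lebesgue_measure R).
Local Open Scope ereal_scope.

Lemma ge0_integral_opp (h : R -> \bar R) : measurable_fun [set: R] h ->
  (forall x, 0 <= h x) -> \int[mu]_x h (- x)%R = \int[mu]_x h x.
Proof.
move=> mh h0.
have mopp : measurable_fun [set: measurableTypeR R]
  (-%R : measurableTypeR R -> measurableTypeR R) by exact: oppr_measurable.
rewrite -(@ge0_integral_pushforward _ _ _ _ _ _ mopp mu setT h)//.
by apply: eq_measure_integral => A mA _; exact: lebesgue_measureN.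
Qed.

(** Almost everywhere statements about R are transported by hand, because the
    Lebesgue measure lives on R seen with another measurability display. *)
Lemma lebesgue_aeS (Q Q' : R -> Prop) : (forall x, Q x -> Q' x) ->
  {ae mu, forall x, Q x} -> {ae mu, forall x, Q' x}.
Proof.
move=> QQ' [N [mN N0 sub]]; exists N; split => // x.
by apply: contra_notP => /(contra_notP (sub x)) /QQ'.
Qed.

Lemma lebesgue_aeS2 (Q1 Q2 Q' : R -> Prop) :
  (forall x, Q1 x -> Q2 x -> Q' x) -> {ae mu, forall x, Q1 x} ->
  {ae mu, forall x, Q2 x} -> {ae mu, forall x, Q' x}.
Proof.
move=> QQ' [N [mN N0 sub]] [M [mM M0 sub']]; exists (N `|` M); split.
- exact: measurableU.
- by rewrite measureU0.
- move=> x; apply: contra_notP => NM; apply: QQ'.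
    by apply: contra_notP NM => xQ; left; exact: sub.
  by apply: contra_notP NM => xQ; right; exact: sub'.
Qed.

Lemma ae_opp (Q : R -> Prop) :
  {ae mu, forall x, Q x} -> {ae mu, forall x, Q (- x)%R}.
Proof.
move=> [N [mN N0 sub]]; exists (-%R @^-1` N); split.
- rewrite -[X in measurable X]setTI; apply: oppr_measurable => //.
- by have := lebesgue_measureN mN; rewrite N0.
- by move=> x /= Qx; exact: sub.
Qed.

End reflection.

Section density.
Context d (T : measurableType d) (R : realType) (P : probability T R).
Variables (Z : {RV P >-> R}) (f : R -> R).
Hypothesis Zf : is_density Z f.
Local Notation mu := (@lebesgue_measure R).
Local Open Scope ereal_scope.

Let mf : measurable_fun [set: R] f. Proof. by case: Zf. Qed.
Let f0 x : (0 <= f x)%R. Proof. by case: Zf. Qed.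

Lemma density_integral1 : \int[mu]_x (f x)%:E = 1.
Proof. by case: Zf => _ _ <-//; exact: probability_setT. Qed.

Lemma density_integrable : mu.-integrable [set: R] (EFin \o f).
Proof.
apply/integrableP; split; first exact/measurable_EFinP.
under eq_integral do rewrite gee0_abs ?lee_fin//.
by rewrite density_integral1 ltry.
Qed.

Lemma density_dominates : distribution P Z `<< mu.
Proof.
case: Zf => _ _ ZE; apply/null_content_dominatesP => A mA A0.
rewrite ZE//; apply: null_set_integral => //.
by apply/measurable_EFinP; exact: measurable_funTS.
Qed.

Lemma density_ae_unique (g : R -> R) :
  measurable_fun [set: R] g -> (forall A : set R, measurable A ->
    distribution P Z A = \int[mu]_(x in A) (g x)%:E) ->
  {ae mu, forall x, f x = g x}.
Proof.
move=> mg ZE.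
have : ae_eq mu setT (EFin \o f) (EFin \o g).
  apply: integral_ae_eq => //; first exact: density_integrable.
    exact/measurable_EFinP.
  by move=> A _ mA; rewrite -ZE//; case: Zf => _ _ ->.
by apply: filterS => x /(_ I) [].
Qed.

(** The law of Z has a Radon-Nikodym derivative, for which the formula is known;
    by uniqueness this derivative is f. *)
Lemma density_integral (h : R -> \bar R) : measurable_fun [set: R] h ->
  (forall x, 0 <= h x) -> \int[P]_w h (Z w) = \int[mu]_x (h x * (f x)%:E).
Proof.
move=> mh h0.
(* the same variable, with the display of the Lebesgue measure *)
pose Z' : {mfun T >-> measurableTypeR R} := HB.pack (Z : T -> measurableTypeR R)
  (isMeasurableFun.Build _ _ T (measurableTypeR R) _
    (measurable_funPT Z : measurable_fun [set: T] (Z : T -> measurableTypeR R))).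
pose nu := distribution P Z'.
have nu_mu : nu `<< mu by exact: density_dominates.
rewrite -(@ge0_integral_distribution _ _ _ _ _ P Z' h)//.
rewrite -(@Radon_Nikodym_SigmaFinite.change_of_variables _ _ _ nu mu nu_mu)//.
set g := Radon_Nikodym_SigmaFinite.f _ _.
have mg : measurable_fun [set: measurableTypeR R] g.
  exact: measurable_int (Radon_Nikodym_SigmaFinite.f_integrable nu_mu).
apply: ge0_ae_eq_integral => //.
- exact: emeasurable_funM.
- by apply: emeasurable_funM => //; exact/measurable_EFinP.
- move=> x _; rewrite mule_ge0//.
  exact: (Radon_Nikodym_SigmaFinite.f_ge0 nu_mu).
- by move=> x _; rewrite mule_ge0 ?lee_fin.
apply: ae_eqe_mul2l; apply: ae_eq_sym.
apply: integral_ae_eq => //; first exact: density_integrable.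
move=> A _ mA; rewrite -Radon_Nikodym_SigmaFinite.f_integral//.
by case: Zf => _ _ <-.
Qed.

Let rad n : R := n.+1%:R^-1.

(** Lebesgue differentiation: the density is the derivative of the distribution
    function almost everywhere. *)
Lemma density_differentiation : {ae mu, forall x,
  ((tail Z (x - n.+1%:R^-1) - tail Z (x + n.+1%:R^-1)) / (2 * n.+1%:R^-1))%R
    @[n --> \oo] --> f x}.
Proof.
pose E x n : set R := `](x - rad n)%R, (x + rad n)%R]%classic.
have r0 n : (0 < rad n)%R by rewrite invr_gt0 ltr0n.
have muE x n : mu (E x n) = (2 * rad n)%:E.
  rewrite lebesgue_measure_itv/= lte_fin ltrD2l gtrN//.
  by rewrite -EFinB; congr EFin; ring.
have nE x : nicely_shrinking x (E x).
  split; first by move=> n; exact: measurable_itv.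
  have r20 n : (0 < 2 * rad n)%R by rewrite mulr_gt0.
  exists (2%R, fun n => PosNum (r20 n)); split => //=.
  - rewrite -[X in _ --> X](mulr0 (2%R : R)); apply: cvgMr.
    exact: cvg_harmonic.
  - move=> n y; rewrite /E/= in_itv/= => /andP[xy yx].
    by rewrite /ball/= ltr_distlC; have := r0 n; lra.
  - move=> n; rewrite muE lebesgue_measure_ball ?(ltW (r20 n))//.
    rewrite -EFinM lee_fin. have := r0 n; rewrite mulr2n; lra.
have locf : locally_integrable setT f.
  apply: open_integrable_locally => //; first exact: openT.
  exact: density_integrable.
apply: lebesgue_aeS (lebesgue_differentiation locf) => x.
move=> /(nice_lebesgue_differentiation nE locf)/fine_cvg; apply: cvg_trans; apply: near_eq_cvg; apply: nearW => n /=.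
rewrite -[(n.+1%:R^-1)%R]/(rad n).
have ZE : \int[mu]_(y in E x n) (f y)%:E =
    (tail Z (x - rad n) - tail Z (x + rad n))%:E.
  rewrite -prob_itvoc; last by have := r0 n; lra.
  by case: Zf => _ _ <-//; exact: measurable_itv.
by rewrite ZE muE inver gt_eqF ?mulr_gt0//= mulrC.
Qed.

End density.

Section lipschitz_tail.
Context d (T : measurableType d) (R : realType) (P : probability T R).
Variables (Y : {RV P >-> R}) (c : R).
Hypothesis c0 : 0 < c.
Hypothesis Yc : forall a b, a <= b -> tail Y a - tail Y b <= c * (b - a).
Local Open Scope ereal_scope.

(** A null set is covered by intervals of small total length, hence of small
    total probability. *)
Lemma lipschitz_dominates : distribution P Y `<< @lebesgue_measure R.
Proof.
apply/null_content_dominatesP => A mA A0.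
apply/eqP; rewrite eq_le measure_ge0 andbT; apply/lee_addgt0Pr => e e0.
rewrite add0e.
have : lebesgue_measure A < (e / c)%:E by rewrite A0 lte_fin divr_gt0.
move=> /ereal_inf_lt[_ [F [mF AF] <-]] Fe.
have mF' i : measurable (F i : set R) by exact: sub_sigma_algebra.
have PF i : distribution P Y (F i) <= c%:E * wlength idfun (F i).
  have := mF i => -[[a b] _ /= <-].
  have [ab|ba] := leP a b; last first.
    rewrite set_itv_ge; last by rewrite bnd_simp -leNgt ltW.
    by rewrite measure0 wlength0 mule0.
  rewrite prob_itvoc// wlength_itv_bnd//= -EFinM lee_fin.
  exact: Yc.
apply: (@le_trans _ _ (\sum_(k <oo) distribution P Y (F k))).
  exact: measure_sigma_subadditive.
apply: (@le_trans _ _ (\sum_(k <oo) c%:E * wlength idfun (F k))).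
  by apply: lee_nneseries => // i _ _; exact: measure_ge0.
rewrite nneseriesZl//.
rewrite [e](_ : _ = c * (e / c))%R; last by rewrite mulrCA divff ?mulr1// gt_eqF.
rewrite EFinM lee_pmul2l ?lte_fin//.
exact: ltW Fe.
Qed.

End lipschitz_tail.

(** * Symmetrizers of an exponential variable *)

Section exponential_law.
Context d (T : measurableType d) (R : realType) (P : probability T R).
Variables (X : {RV P >-> R}) (lambda : R).
Hypothesis lambda0 : 0 < lambda.
Hypothesis expX : exponential_rv X lambda.
Implicit Types x t h : R.

Lemma exponential_nonneg : {ae P, forall w, 0 <= X w}.
Proof.
exists [set w | X w < 0]; split.
- rewrite (_ : [set _ | _] = X @^-1` `]-oo, 0[%classic).
    by rewrite -[X in measurable X]setTI; exact: measurable_funPT.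
  by apply/seteqP; split => w /=; rewrite in_itv.
- rewrite (_ : [set _ | _] = X @^-1` `]-oo, 0[%classic); last first.
    by apply/seteqP; split => w /=; rewrite in_itv.
  rewrite -[LHS]/(distribution P X _); case: expX => _ _ -> //.
  apply: integral0_eq => x /=; rewrite in_itv/= => x0.
  by rewrite lt0_exponential_pdf.
- by move=> w /= /negP; rewrite -ltNge.
Qed.

Lemma exponential_tail t : tail X t = exp_tail lambda t.
Proof.
have X_itv s : 0 <= s ->
    distribution P X `[0, s]%classic = (1 - expR (- (lambda * s)))%:E.
  have [_ _ XE] := expX; rewrite le_eqVlt => /predU1P[<-|s0]; rewrite XE//.
    by rewrite set_itv1 integral_set1 mulr0 oppr0 expR0 subrr.
  rewrite -[LHS]/(exponential_prob lambda `[0, s]%classic).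
  by rewrite exponential_prob_itv0c// mulNr EFinB.
have [N [mN N0 sub]] := exponential_nonneg.
suff : P [set w | X w <= t] = (1 - exp_tail lambda t)%:E.
  by rewrite prob_le => -[] /eqP; rewrite (inj_eq (addrI _)) eqr_opp => /eqP.
have [t0|t0] := leP 0 t.
  have mI : measurable (X @^-1` `[0, t]%classic).
    by rewrite -[X in measurable X]setTI; exact: measurable_funPT.
  rewrite exp_tail_ge0// -X_itv//; apply/eqP; rewrite eq_le; apply/andP; split.
    rewrite -[leRHS]adde0 -[X in (_ <= _ + X)%E]N0.
    apply: le_trans (measureU2 _ mI mN); apply: le_measure; rewrite ?inE//.
    - exact: measurable_le.
    - exact: measurableU.
    move=> w /= Xt; have [Xw|Xw] := leP 0 (X w).
      by left; rewrite in_itv/= Xw.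
    by right; apply: sub => /=; apply/negP; rewrite -ltNge.
  apply: (le_measure P); rewrite ?inE//; first exact: measurable_le.
  by move=> w /=; rewrite in_itv/= => /andP[].
rewrite exp_tail_le0 ?(ltW t0)// subrr.
apply: (subset_measure0 _ mN) => //; first exact: measurable_le.
move=> w /= Xt; apply: sub => /=; apply/negP; rewrite -ltNge.
exact: le_lt_trans t0.
Qed.

Lemma exponential_tail_abs t : 0 <= t ->
  tail (absRV X) t = expR (- (lambda * t)).
Proof.
move=> t0; rewrite -exp_tail_ge0// -exponential_tail.
have /tail_same_law -> // : same_law P (absRV X) X.
apply: same_law_ae => //.
by apply: filterS exponential_nonneg => w Xw /=; rewrite ger0_norm.
Qed.

(** x^2 exp (- lambda x) is at most a multiple of exp (- lambda x / 2), which is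
    a multiple of another exponential density. *)
Lemma exponential_sqr_integrable : (\int[P]_w (X w ^+ 2)%:E < +oo)%E.
Proof.
have msqr : measurable_fun [set: R] (fun x : R => (x ^+ 2)%:E).
  by apply/measurable_EFinP; exact: exprn_measurable.
rewrite (density_integral (h := fun x => (x ^+ 2)%:E) expX)//; last first.
  by move=> x; rewrite lee_fin sqr_ge0.
have l2 : 0 < lambda / 2 by rewrite divr_gt0.
apply: (@le_lt_trans _ _ (\int[lebesgue_measure]_x
    ((32 / lambda ^+ 2)%:E * (exponential_pdf (lambda / 2) x)%:E))%E); last first.
  rewrite ge0_integralZl//=; last 3 first.
  - apply/measurable_EFinP; exact: measurable_exponential_pdf.
  - by move=> x _; rewrite lee_fin exponential_pdf_ge0// ltW.
  - by rewrite lee_fin divr_ge0// sqr_ge0.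
  by rewrite integral_exponential_pdf// mule1 ltry.
apply: ge0_le_integral => //=.
- move=> x _; rewrite -EFinM lee_fin mulr_ge0 ?sqr_ge0//.
  by rewrite exponential_pdf_ge0// ltW.
- apply: emeasurable_funM => //; apply/measurable_EFinP.
  exact: measurable_exponential_pdf.
- apply: emeasurable_funM => //; apply/measurable_EFinP.
  exact: measurable_exponential_pdf.
move=> x _; rewrite -!EFinM lee_fin.
have [x0|x0] := ltP x 0; first by rewrite !lt0_exponential_pdf// !mulr0.
rewrite !exponential_pdfE//.
set e := expR (- (lambda / 2) * x).
have -> : expR (- lambda * x) = e * e.
  by rewrite -expRD; congr expR; field.
have e0 : 0 < e by exact: expR_gt0.
(* exp (y) >= (1 + y / 2)^2 at y = lambda x / 2 *)
pose y := lambda * x / 4.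
have y0 : 0 <= y by rewrite divr_ge0// mulr_ge0// ltW.
have ey : e * (1 + y) ^+ 2 <= 1.
  rewrite [leRHS](_ : 1 = e * (expR y) ^+ 2); last first.
    rewrite -expRM_natl -expRD -[LHS]expR0; by congr expR; rewrite /y; field.
  rewrite ler_pM2l// ler_pXn2r ?nnegrE ?addr_ge0 ?expR_ge0//.
  exact: expR_ge1Dx.
have xy : x ^+ 2 = 16 / lambda ^+ 2 * y ^+ 2.
  rewrite /y; field; lra.
have -> : 32 / lambda ^+ 2 * (lambda / 2 * e) = 16 / lambda ^+ 2 * (lambda * e * 1).
  by field; lra.
have -> : x ^+ 2 * (lambda * (e * e)) =
    16 / lambda ^+ 2 * (lambda * e * (e * y ^+ 2)) by rewrite xy; ring.
apply: ler_wpM2l; first by rewrite divr_ge0// sqr_ge0.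
apply: ler_wpM2l; first by rewrite mulr_ge0// ltW.
apply: le_trans ey; rewrite ler_pM2l//.
by rewrite ler_pXn2r ?nnegrE ?addr_ge0// lerDr.
Qed.

End exponential_law.

Section exponential_symmetrizer.
Context d (T : measurableType d) (R : realType) (P : probability T R).
Variables (X Y : {RV P >-> R}) (lambda : R).
Hypothesis lambda0 : 0 < lambda.
Hypothesis expX : exponential_rv X lambda.
Hypothesis symXY : independent_symmetrizer X Y.
Implicit Types x y t h : R.

Local Notation K := (smooth Y lambda).

Lemma exponential_sum_gt x : P [set w | x < X w + Y w] = (K x)%:E.
Proof.
have [indXY _] := symXY.
rewrite independent_sum_gt// /smooth /Rintegral fineK.
  by apply: eq_integral => w _; rewrite (exponential_tail lambda0 expX).
by apply: (integrable_fin_num measurableT); exact: integrable_exp_tail.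
Qed.

(** The factor tends to 1 with h. This replaces continuity arguments below, and
    removes atoms at the ends of intervals. *)
Lemma le_of_exp_factor (a b : R) :
  (forall h, 0 < h -> a <= expR (lambda * h) * b) -> a <= b.
Proof.
move=> ab; rewrite leNgt; apply/negP => ba.
have [b0|b0] := leP b 0.
  have := ab 1 ltr01; apply/negP; rewrite -ltNge (le_lt_trans _ ba)//.
  rewrite -[leRHS]mul1r ler_wnM2r// -[leLHS]expR0 ler_expR mulr1.
  exact: ltW.
have ab1 : 1 < a / b by rewrite ltr_pdivlMr// mul1r.
have r0 : 0 < ln (a / b) by rewrite ln_gt0.
have := ab (ln (a / b) / (2 * lambda)); rewrite divr_gt0 ?mulr_gt0// => /(_ isT).
have -> : lambda * (ln (a / b) / (2 * lambda)) = ln (a / b) / 2.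
  by field; rewrite ?(gt_eqF lambda0).
apply/negP; rewrite -ltNge -ltr_pdivlMr//.
rewrite -[ltRHS](@lnK _ (a / b)) ?posrE ?divr_gt0 ?(lt_trans b0 ba)//.
by rewrite ltr_expR; lra.
Qed.

Lemma smooth_le_exp x h : 0 <= h -> K x <= expR (lambda * h) * K (x + h).
Proof.
move=> h0; have := smooth_hazard Y lambda0 x h0.
by rewrite expRN mulrC ler_pdivrMr ?expR_gt0// mulrC.
Qed.

(** Symmetry of X + Y; the hazard bound excludes an atom of X + Y at - x. *)
Lemma smooth_symmetric x : K x + K (- x) = 1.
Proof.
have [_ symS] := symXY.
have SE : P [set w | x < X w + Y w] = P [set w | X w + Y w < - x].
  have := symS `]x, +oo[%classic (measurable_itv _).
  rewrite !preimage_gt => ->; congr (P _).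
  by apply/seteqP; split => w /=; rewrite ltrNr.
have mS : measurable_fun [set: T] (X \+ Y) by exact: measurable_funD.
have K_lt y : P [set w | X w + Y w <= y] = (1 - K y)%:E.
  have := prob_le (toRV P mS) y => /= ->; congr (1 - _)%:E.
  by apply/EFin_inj; rewrite -exponential_sum_gt tailE.
have mlt y : measurable [set w | X w + Y w < y].
  have -> : [set w | X w + Y w < y] = (X \+ Y) @^-1` `]-oo, y[%classic.
    by apply/seteqP; split => w /=; rewrite in_itv.
  by rewrite -[X in measurable X]setTI; exact: mS.
have mle y : measurable [set w | X w + Y w <= y].
  exact: (measurable_le (toRV P mS)).
apply/eqP; rewrite eq_le; apply/andP; split.
  rewrite -lerBrDr -lee_fin -exponential_sum_gt SE -K_lt.
  by apply: le_measure; rewrite ?inE// => w /=; exact: ltW.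
rewrite -lerBlDl; apply: le_of_exp_factor => h h0.
apply: (@le_trans _ _ (K (- x - h))); last first.
  by have := smooth_le_exp (- x - h) (ltW h0); rewrite subrK.
rewrite lerBlDr -lerBlDl -lee_fin -K_lt -exponential_sum_gt SE.
apply: le_measure; rewrite ?inE// => w /= /le_lt_trans; apply; lra.
Qed.

Definition two_sided_tail x := tail Y x + (1 - tail Y (- x)).

(** Comparing, for the two mirror images of one interval, the decay of the tail
    of X + Y with the excess of this tail over that of Y. *)
Lemma two_sided_tail_bounds x h : 0 < h ->
  two_sided_tail (x + h) <= K x + K (x + h) <= two_sided_tail x.
Proof.
move=> h0; have hh := ltW h0.
have e0 : 0 < 1 - expR (- (lambda * h)).
  by rewrite subr_gt0 -[ltRHS]expR0 ltr_expR oppr_lt0 mulr_gt0.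
have dec1 := smooth_decay_ge Y lambda0 x hh.
have dec2 := smooth_decay_le Y lambda0 x hh.
have inc1 := smooth_decay_ge Y lambda0 (- x - h) hh.
have inc2 := smooth_decay_le Y lambda0 (- x - h) hh.
have s1 := smooth_symmetric x; have s2 := smooth_symmetric (x + h).
rewrite opprD in s2; rewrite subrK in inc1 inc2.
have E : K (- x - h) - K (- x) = K x - K (x + h).
  move: s1 s2; clear.
  by move: (K x) (K (x + h)) (K (- x)) (K (- x - h)) => a b a' b'; lra.
rewrite E in inc1 inc2.
have := le_trans dec1 inc2; rewrite ler_pM2l// => A1.
have := le_trans inc1 dec2; rewrite ler_pM2l// => A2.
rewrite /two_sided_tail opprD; move: A1 A2 s1 s2; clear.
move: (K x) (K (x + h)) (K (- x)) (K (- x - h)) => a b a' b'.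
move: (tail Y x) (tail Y (x + h)) (tail Y (- x)) (tail Y (- x - h)) => p q p' q'.
by move=> A1 A2 s1 s2; apply/andP; split; lra.
Qed.

(** The bounds for h tending to 0: |Y| has the tail of |X + Y|. *)
Lemma two_sided_tailE x : two_sided_tail x = 2 * K x.
Proof.
have K0 y : 0 <= K y := smooth_ge0 Y lambda y.
apply/eqP; rewrite eq_le; apply/andP; split; apply: le_of_exp_factor => h h0.
- have /andP[D1 _] := two_sided_tail_bounds (x - h) h0; rewrite subrK in D1.
  have := smooth_le_exp (x - h) (ltW h0); rewrite subrK => K1.
  have Kle : K x <= K (x - h) by apply: smooth_le => //; rewrite gerBl ltW.
  rewrite (le_trans D1)// mulrCA; move: K1 Kle; clear.
  move: (K x) (K (x - h)) (expR _ * _) => a b c; lra.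
- have /andP[_ D1] := two_sided_tail_bounds x h0.
  have K1 := smooth_le_exp x (ltW h0).
  have Kle : K (x + h) <= K x by apply: smooth_le => //; rewrite lerDl ltW.
  have e0 := expR_gt0 (lambda * h).
  apply: (@le_trans _ _ (expR (lambda * h) * (2 * K (x + h)))).
    by rewrite mulrCA ler_pM2l.
  rewrite ler_pM2l// (le_trans _ D1)//; move: Kle; clear.
  move: (K x) (K (x + h)) => a b; lra.
Qed.

End exponential_symmetrizer.

Section exponential_symmetrizer_law.
Context d (T : measurableType d) (R : realType) (P : probability T R).
Variables (X Y : {RV P >-> R}) (lambda : R).
Hypothesis lambda0 : 0 < lambda.
Hypothesis expX : exponential_rv X lambda.
Hypothesis symXY : independent_symmetrizer X Y.
Implicit Types x y t h a b : R.

Local Notation K := (smooth Y lambda).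

Let Ksym x : K x + K (- x) = 1.
Proof. exact: (smooth_symmetric lambda0 expX symXY). Qed.

Let Kle x y : x <= y -> K y <= K x.
Proof. exact: smooth_le. Qed.

Lemma smooth_at0 : K 0 = 1 / 2.
Proof. by have := Ksym 0; rewrite oppr0; move: (K 0) => k; lra. Qed.

Lemma smooth_ge_exp x : 0 <= x -> expR (- (lambda * x)) <= 2 * K x.
Proof.
move=> x0; have := smooth_hazard Y lambda0 0 x0.
by rewrite smooth_at0 add0r; move: (K x) (expR _) => a b; lra.
Qed.

Lemma smooth_gt0 x : 0 < K x.
Proof.
have [x0|x0] := leP 0 x.
  by have := smooth_ge_exp x0; have := expR_gt0 (- (lambda * x));
    move: (K x) (expR _) => a b; lra.
apply: (@lt_le_trans _ _ (K 0)); first by rewrite smooth_at0; lra.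
exact/Kle/ltW.
Qed.

Lemma smooth_decrement_le a b : a <= b -> K a - K b <= lambda * (b - a) * K a.
Proof.
move=> ab; have ba : 0 <= b - a by rewrite subr_ge0.
have := smooth_hazard Y lambda0 a ba; rewrite subrKC.
have := expR_ge1Dx (- (lambda * (b - a))).
have := smooth_gt0 a; move: (K a) (K b) (lambda * _) (expR _) => k l m e.
by move=> k0 em lk; nra.
Qed.

(** The tail of X + Y controls Y on the union of an interval and its mirror
    image. *)
Lemma tail_decrement_mirror a b :
  (tail Y a - tail Y b) + (tail Y (- b) - tail Y (- a)) = 2 * (K a - K b).
Proof.
have := two_sided_tailE lambda0 expX symXY a.
have := two_sided_tailE lambda0 expX symXY b.
rewrite /two_sided_tail; move: (K a) (K b) => k l.
by move: (tail Y a) (tail Y b) (tail Y (- a)) (tail Y (- b)) => p q p' q'; lra.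
Qed.

Lemma tail_decrement_le a b : a <= b -> tail Y a - tail Y b <= 2 * (K a - K b).
Proof.
move=> ab; rewrite -tail_decrement_mirror lerDl subr_ge0.
by apply: tail_le; rewrite lerN2.
Qed.

Lemma tail_decrement_mirror_le a b : a <= b ->
  tail Y (- b) - tail Y (- a) <= 2 * (K a - K b).
Proof.
move=> ab; rewrite -tail_decrement_mirror lerDr subr_ge0.
exact: tail_le.
Qed.

Lemma tail_lipschitz a b : a <= b ->
  tail Y a - tail Y b <= 2 * lambda * (b - a).
Proof.
move=> ab; rewrite (_ : 2 * _ * _ = 2 * (lambda * (b - a))); last by ring.
have := tail_decrement_le ab; have := smooth_decrement_le ab.
have := smooth_le1 Y lambda a.
have : 0 <= lambda * (b - a) by rewrite mulr_ge0 ?subr_ge0// ltW.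
move: (lambda * _) (K a) (K b) (tail Y a) (tail Y b).
by move=> m k l p q m0 k1 kl pq; nra.
Qed.

Lemma exponential_symmetrizer_dominates :
  distribution P Y `<< @lebesgue_measure R.
Proof.
apply: (lipschitz_dominates (c := 2 * lambda)); first by rewrite mulr_gt0.
exact: tail_lipschitz.
Qed.

(** The two-sided tail is the tail of |Y| up to an atom of Y at - x, which the
    hazard bound excludes. *)
Lemma tail_abs_exponential x : 0 <= x -> tail (absRV Y) x = 2 * K x.
Proof.
move=> x0.
have absE y : 0 <= y -> [set w | y < absRV Y w] =
    [set w | y < Y w] `|` [set w | Y w < - y].
  move=> y0; apply/seteqP; split => w /=.
    by rewrite ltr_normr => /orP[|]; [left|right; rewrite ltrNr].
  by rewrite ltr_normr => -[->//|]; rewrite ltrNr => ->; rewrite orbT.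
have mlt y : measurable [set w | Y w < y].
  have -> : [set w | Y w < y] = Y @^-1` `]-oo, y[%classic.
    by apply/seteqP; split => w /=; rewrite in_itv.
  by rewrite -[X in measurable X]setTI; exact: measurable_funPT.
have disj y z : - z <= y ->
    [set w | y < Y w] `&` [set w | Y w <= - z] = set0.
  move=> zy; rewrite -subset0 => w [/= yY Yz].
  by have := lt_le_trans yY (le_trans Yz zy); rewrite ltxx.
have DE y z : - z <= y -> P ([set w | y < Y w] `|` [set w | Y w <= - z]) =
    (tail Y y + (1 - tail Y (- z)))%:E.
  move=> zy; rewrite EFinD tailE -prob_le; apply: measureU; last exact: disj.
    exact: measurable_gt.
  exact: measurable_le.
have D y : two_sided_tail Y y = 2 * K y := two_sided_tailE lambda0 expX symXY y.
have xx y : 0 <= y -> - y <= y by move=> y0; rewrite (le_trans _ y0)// oppr_le0.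
apply/eqP; rewrite eq_le; apply/andP; split.
  rewrite -D -lee_fin tailE absE// -DE ?xx//; apply: le_measure; rewrite ?inE.
  - by apply: measurableU => //; exact: measurable_gt.
  - by apply: measurableU; [exact: measurable_gt|exact: measurable_le].
  - by move=> w [?|/ltW ?]; [left|right].
apply: (le_of_exp_factor lambda0) => h h0.
have K1 := smooth_le_exp Y lambda0 x (ltW h0).
apply: (@le_trans _ _ (expR (lambda * h) * (2 * K (x + h)))).
  by rewrite mulrCA ler_pM2l.
rewrite ler_pM2l ?expR_gt0// -D -lee_fin tailE absE//.
have xh : 0 <= x + h by rewrite addr_ge0// ltW.
rewrite -DE ?xx//; apply: le_measure; rewrite ?inE.
- by apply: measurableU; [exact: measurable_gt|exact: measurable_le].
- by apply: measurableU => //; exact: measurable_gt.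
move=> w [/= xhY|/= Yxh]; [left|right] => /=.
  by rewrite (le_lt_trans _ xhY)// lerDl ltW.
by rewrite (le_lt_trans Yxh)// ltrN2 ltrDl.
Qed.

Lemma exponential_tail_abs_le x : 0 <= x ->
  tail (absRV X) x <= tail (absRV Y) x.
Proof.
move=> x0; rewrite (exponential_tail_abs lambda0 expX)// tail_abs_exponential//.
exact: smooth_ge_exp.
Qed.

Lemma tail_lt1 x : tail Y x < 1.
Proof.
rewrite lt_neqAle tail_le1 andbT; apply/negP => /eqP Yx.
have := smooth_tail_le Y lambda0 x; have := smooth_le1 Y lambda x.
have := Ksym x; have := smooth_gt0 (- x); rewrite Yx.
by move: (K x) (K (- x)) => k l; lra.
Qed.

Lemma cvg_smooth x : K y @[y --> x] --> K x.
Proof.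
apply/cvgrPdist_le => e e0; near=> y.
have yx : `|x - y| <= e / lambda.
  by near: y; apply: cvgr_dist_le => //; rewrite divr_gt0.
have H a b : a <= b -> `|a - b| <= e / lambda -> `|K a - K b| <= e.
  move=> ab abe; rewrite ger0_norm ?subr_ge0 ?Kle//.
  apply: (le_trans (smooth_decrement_le ab)).
  apply: (@le_trans _ _ (lambda * (b - a))).
    by rewrite ler_piMr ?mulr_ge0 ?subr_ge0 ?(ltW lambda0)// smooth_le1.
  rewrite mulrC -ler_pdivlMr//; apply: le_trans abe.
  by rewrite distrC ler_norm.
have [xy|yx'] := leP x y; first exact: H.
by rewrite distrC H// 1?distrC// ltW.
Unshelve. all: by end_near. Qed.

Section density_bounds.
Variable f : R -> R.
Hypothesis Yf : is_density Y f.
Local Notation mu := (@lebesgue_measure R).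

Let rad n : R := n.+1%:R^-1.
Let rad0 n : 0 < rad n. Proof. by rewrite invr_gt0 ltr0n. Qed.

Let decay x n :
  2 * (K (x - rad n) - K (x + rad n)) / (2 * rad n) <= 2 * lambda * K (x - rad n).
Proof.
rewrite ler_pdivrMr ?mulr_gt0//.
have xr : x - rad n <= x + rad n by rewrite lerD2l ge0_cp// ltW.
have := smooth_decrement_le xr; rewrite (_ : x + rad n - (x - rad n) = 2 * rad n); last by ring.
move: (K (x - rad n)) (K (x + rad n)) (rad n) => a b r; nra.
Qed.

Let cvg_bound x : 2 * lambda * K (x - rad n) @[n --> \oo] --> 2 * lambda * K x.
Proof.
apply: cvgMr; apply: continuous_cvg; first exact: cvg_smooth.
rewrite -[X in _ --> X]subr0; apply: cvgB; first exact: cvg_cst.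
exact: cvg_harmonic.
Qed.

(** Both one-sided estimates come from the decay of the tail of X + Y at rate at
    most lambda. *)
Lemma density_le_smooth : {ae mu, forall x, f x <= 2 * lambda * K `|x|}.
Proof.
have H1 : {ae mu, forall x, f x <= 2 * lambda * K x}.
  apply: lebesgue_aeS (density_differentiation Yf) => x fx.
  apply: (ler_cvg_to fx (@cvg_bound x)); apply: nearW => n.
  apply: le_trans (decay x n); rewrite ler_pM2r ?invr_gt0 ?mulr_gt0//.
  by apply: tail_decrement_le; rewrite lerD2l ge0_cp// ltW.
have H2 : {ae mu, forall x, f (- x) <= 2 * lambda * K x}.
  apply: lebesgue_aeS (ae_opp (density_differentiation Yf)) => x fx.
  apply: (ler_cvg_to fx (@cvg_bound x)); apply: nearW => n.
  apply: le_trans (decay x n); rewrite ler_pM2r ?invr_gt0 ?mulr_gt0//.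
  rewrite -opprD [in leLHS](_ : - x + n.+1%:R^-1 = - (x - n.+1%:R^-1)); last by ring.
  by apply: tail_decrement_mirror_le; rewrite lerD2l ge0_cp// ltW.
apply: lebesgue_aeS2 H1 (ae_opp H2) => x; rewrite opprK => f1 f2.
by have [x0|x0] := leP 0 x; [rewrite ger0_norm|rewrite ltr0_norm].
Qed.

(** The tail of X + Y strictly exceeds that of Y; both are continuous, so that
    the excess, which drives the decay, persists near x. *)
Let excess_near x : exists2 c, 0 < c & \forall n \near \oo,
  c <= 2 * (K (x - rad n) - K (x + rad n)) / (2 * rad n).
Proof.
pose J := K x - tail Y x.
have J0 : 0 < J by rewrite subr_gt0 smooth_tail_lt// tail_lt1.
exists (lambda * expR (- (2 * lambda)) * J).
  by rewrite !mulr_gt0 ?expR_gt0.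
have cv : rad n @[n --> \oo] --> 0 by exact: cvg_harmonic.
have Jl : 0 < J / (4 * lambda) by rewrite divr_gt0 ?mulr_gt0.
near=> n.
have rJ : rad n < J / (4 * lambda) by near: n; exact: (cvgr_lt _ cv _ Jl).
have r1 : rad n <= 1 by rewrite /rad invf_le1 ?ltr0n// ler1n.
have rn := rad0 n; move: (rad n) rn rJ r1 => r r0 rJ r1.
rewrite ler_pdivlMr ?mulr_gt0//.
have h0 : 0 <= 2 * r by rewrite mulr_ge0// ltW.
have := smooth_decay_ge Y lambda0 (x - r) h0.
rewrite (_ : x - r + 2 * r = x + r); last by ring.
have xr : x - r <= x by rewrite gerBl ltW.
have Jr : J / 2 <= K (x - r) - tail Y (x - r).
  have := tail_lipschitz xr; have := Kle xr.
  rewrite (_ : x - (x - r) = r); last by ring.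
  have : 2 * lambda * r <= J / 2.
    move: rJ; rewrite ltr_pdivlMr ?mulr_gt0// => rJ; nra.
  rewrite /J; move: (K x) (K (x - r)) (tail Y x) (tail Y (x - r)) => a b p q.
  lra.
have e1 : 2 * lambda * r * expR (- (2 * lambda)) <= 1 - expR (- (lambda * (2 * r))).
  set y := lambda * (2 * r).
  have y0 : 0 <= y by rewrite mulr_ge0// ltW.
  have ey : 1 + y <= expR y := expR_ge1Dx y.
  have ye : expR (- (2 * lambda)) <= expR (- y).
    by rewrite ler_expR lerN2 /y mulrCA ler_pM2l// ler_piMr// ltW.
  have -> : 2 * lambda * r = y by rewrite /y; ring.
  apply: (@le_trans _ _ (y * expR (- y))); first exact: ler_wpM2l.
  have eyN : expR y * expR (- y) = 1 by rewrite -expRD subrr expR0.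
  have := expR_gt0 (- y); move: (expR y) (expR (- y)) ey eyN => a b; nra.
set e := expR (- (2 * lambda)) in e1 *; set e' := expR _ in e1 *.
have ee : 0 < e by exact: expR_gt0.
have K2 := ler_pM _ _ e1 Jr.
move=> H.
have : 2 * lambda * r * e * (J / 2) <= K (x - r) - K (x + r).
  apply: le_trans H; apply: K2; first by rewrite !mulr_ge0// ltW.
  by rewrite divr_ge0// ltW.
move: (K (x - r)) (K (x + r)) => a b; nra.
Unshelve. all: by end_near. Qed.

(** The density of |Y| does not vanish: the tail of X + Y decays at positive
    rate everywhere. *)
Lemma density_mirror_gt0 : {ae mu, forall x, 0 < f x + f (- x)}.
Proof.
apply: lebesgue_aeS2 (density_differentiation Yf)
  (ae_opp (density_differentiation Yf)) => x fx fNx.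
have [c c0 cn] := excess_near x.
apply: (lt_le_trans c0); apply: cvgr_to_ge (cvgD fx fNx) _.
apply: filterS cn => n /le_trans; apply; rewrite -mulrDl.
rewrite ler_pM2r ?invr_gt0 ?mulr_gt0// -tail_decrement_mirror /rad.
rewrite opprD [in leLHS](_ : - (x - n.+1%:R^-1) = - x + n.+1%:R^-1)//.
by ring.
Qed.

End density_bounds.

End exponential_symmetrizer_law.

Section exponential_integral_transform.
Context d (T : measurableType d) (R : realType) (P : probability T R).
Variables (X Y : {RV P >-> R}) (lambda : R).
Hypothesis lambda0 : 0 < lambda.
Hypothesis expX : exponential_rv X lambda.
Hypothesis symXY : independent_symmetrizer X Y.
Implicit Types x y t h a b : R.

Local Notation K := (smooth Y lambda).

Let Kle x y : x <= y -> K y <= K x.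
Proof. exact: smooth_le. Qed.

Let K0 x : 0 < K x.
Proof. exact: (smooth_gt0 lambda0 expX symXY). Qed.

(** The information - ln P (|Y| > |x|), which for an exponential variable is
    lambda |x|. *)
Definition log_tail x : R := - ln (2 * K `|x|).

Lemma log_tail_ge0 x : 0 <= log_tail x.
Proof.
rewrite oppr_ge0 ln_le0//.
have := smooth_at0 lambda0 expX symXY; have := Kle (normr_ge0 x).
by move: (K 0) (K `|x|) => a b; lra.
Qed.

Lemma measurable_smooth : measurable_fun [set: R] K.
Proof.
apply: continuous_measurable_fun => x.
exact: (cvg_smooth lambda0 expX symXY).
Qed.

Lemma measurable_log_tail : measurable_fun [set: R] log_tail.
Proof.
apply: (measurableT_comp (@oppr_measurable R setT)).
apply: measurableT_comp; first exact: measurable_ln.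
apply: measurable_funM => //.
by apply: measurableT_comp; [exact: measurable_smooth|exact: normr_measurable].
Qed.

Let cvg_smooth_pinfty : K x @[x --> +oo] --> (0 : R).
Proof.
have mS : measurable_fun [set: T] (X \+ Y) by exact: measurable_funD.
rewrite (_ : K = tail (toRV P mS)); first exact: cvg_tail_pinfty.
apply/funext => x; apply/EFin_inj; rewrite tailE.
by rewrite -(exponential_sum_gt lambda0 expX symXY).
Qed.

Lemma smooth_onto u : 0 < u <= 1 -> exists2 x, 0 <= x & 2 * K x = u.
Proof.
move=> /andP[u0 u1].
have u20 : 0 < u / 2 by rewrite divr_gt0.
have [M [_ HM]] : \forall x \near +oo, K x < u / 2 by exact: cvgr_lt cvg_smooth_pinfty _ u20.
pose b := `|M| + 1.
have Kb : K b < u / 2.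
  by apply: HM; rewrite /b (le_lt_trans (ler_norm _))// ltrDl.
have b0 : 0 <= b by rewrite addr_ge0.
have [| |x] := @IVT R K 0 b (u / 2) b0.
- apply: continuous_subspaceT => x; exact: (cvg_smooth lambda0 expX symXY).
- rewrite (smooth_at0 lambda0 expX symXY); rewrite ge_min le_max (ltW Kb).
  by rewrite orbT/= ler_pM2r ?invr_gt0// u1.
rewrite in_itv/= => /andP[x0 _] Kx; exists x => //.
by rewrite Kx; field.
Qed.

Let log_tailY : T -> R := log_tail \o Y.
Let mlog_tailY : measurable_fun [set: T] log_tailY.
Proof. by apply: measurableT_comp => //; exact: measurable_log_tail. Qed.
Let mscale : measurable_fun [set: T] (fun w => lambda * `|X w|).
Proof.
by apply: measurable_funM => //; exact: measurable_norm.
Qed.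

Let tail_log t : 0 <= t -> tail (toRV P mlog_tailY) t = expR (- t).
Proof.
have onto s : 0 <= s -> exists2 x, 0 <= x & 2 * K x = expR (- s).
  move=> s0; apply: smooth_onto; rewrite expR_gt0/= -[leRHS]expR0 ler_expR.
  by rewrite oppr_le0.
have log_lt s x w : 0 <= x -> 2 * K x = expR (- s) -> s < log_tail (Y w) ->
    x < `|Y w|.
  move=> x0 xs sY; rewrite ltNge; apply/negP => Yx.
  have := Kle Yx; rewrite -(ler_pM2l (ltr0Sn R 1)) xs.
  rewrite -[leRHS]lnK ?posrE ?mulr_gt0// ler_expR lerNl.
  by rewrite leNgt sY.
have log_le s x w : 0 <= x -> 2 * K x = expR (- s) -> x < `|Y w| ->
    s <= log_tail (Y w).
  move=> x0 xs Yx; rewrite lerNr -[leRHS]expRK ler_ln ?posrE ?expR_gt0 ?mulr_gt0//.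
  by rewrite -xs ler_pM2l// Kle// ltW.
move=> t0; apply/eqP; rewrite eq_le; apply/andP; split.
  have [x x0 xt] := onto t t0.
  rewrite -xt -(tail_abs_exponential lambda0 expX symXY)//.
  rewrite -lee_fin !tailE; apply: le_measure; rewrite ?inE.
  - exact: (measurable_gt (toRV P mlog_tailY)).
  - exact: (measurable_gt (absRV Y)).
  - by move=> w /=; exact: log_lt.
apply: (@le_of_exp_factor R 1) => // h h0; rewrite mul1r.
have th : 0 <= t + h by rewrite addr_ge0// ltW.
have [x x0 xt] := onto (t + h) th.
have -> : expR (- t) = expR h * expR (- (t + h)).
  by rewrite -expRD; congr expR; ring.
rewrite ler_pM2l ?expR_gt0// -xt.
rewrite -(tail_abs_exponential lambda0 expX symXY)//.
rewrite -lee_fin !tailE; apply: le_measure; rewrite ?inE.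
- exact: (measurable_gt (absRV Y)).
- exact: (measurable_gt (toRV P mlog_tailY)).
move=> w /= Yx; apply: (@lt_le_trans _ _ (t + h)); first by rewrite ltrDl.
exact: log_le Yx.
Qed.

(** The probability integral transform: the tail of |Y|, evaluated at |Y|, is
    uniform, and so is the tail of X at X. *)
Lemma log_tail_law : same_law P (log_tail \o Y) (fun w => lambda * `|X w|).
Proof.
apply: (@same_law_tail _ _ _ P (toRV P mlog_tailY) (toRV P mscale)) => t.
have [t0|t0] := leP 0 t.
  rewrite tail_log//.
  have -> : tail (toRV P mscale) t = tail (absRV X) (t / lambda).
    congr (fine (P _)); apply/seteqP; split => w /=.
      by rewrite ltr_pdivrMr// mulrC.
    by rewrite ltr_pdivrMr// mulrC.
  rewrite (exponential_tail_abs lambda0 expX) ?divr_ge0 ?(ltW lambda0)//.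
  by congr (expR (- _)); field; rewrite gt_eqF.
congr (fine (P _)); apply/seteqP; split => w _ /=.
  by rewrite (lt_le_trans t0)// mulr_ge0// ltW.
by rewrite (lt_le_trans t0)// log_tail_ge0.
Qed.

Section densities.
Variables (fX fY : R -> R).
Hypothesis XfX : is_density X fX.
Hypothesis YfY : is_density Y fY.
Local Notation mu := (@lebesgue_measure R).

Let mfY : measurable_fun [set: R] fY. Proof. by case: YfY. Qed.
Let fY0 x : 0 <= fY x. Proof. by case: YfY. Qed.
Let mfX : measurable_fun [set: R] fX. Proof. by case: XfX. Qed.
Let fX0 x : 0 <= fX x. Proof. by case: XfX. Qed.

Lemma density_exponential_ae : {ae mu, forall x, fX x = exponential_pdf lambda x}.
Proof.
apply: (density_ae_unique XfX); first exact: measurable_exponential_pdf.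
by move=> A mA; case: expX => _ _ ->.
Qed.

(** For W nonnegative, the integral of fX W(- ln (fX / lambda)) is the mean of W
    at an exponential variable of rate one, hence also that of W at the log-tail
    of Y. *)
Lemma integral_log_tail (W : R -> R) : measurable_fun [set: R] W ->
  (forall t, 0 <= W t) ->
  (\int[mu]_x (W (log_tail x) * fY x)%:E =
   \int[mu]_x (W (- ln (fX x / lambda)) * fX x)%:E)%E.
Proof.
move=> mW W0.
have mE : measurable_fun [set: R] (fun t => (W t)%:E).
  exact/measurable_EFinP.
transitivity (\int[P]_w (W (log_tail (Y w)))%:E)%E.
  rewrite (density_integral (h := fun x => (W (log_tail x))%:E) YfY)//.
    by apply/measurable_EFinP; exact: (measurableT_comp mW measurable_log_tail).
  by move=> x; rewrite lee_fin.
rewrite (ge0_same_law_integral (h := fun t => (W t)%:E) mlog_tailY mscale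
  mE _ log_tail_law)//.
have ml : measurable_fun [set: R] (fun x => lambda * `|x|).
  by apply: measurable_funM => //; exact: normr_measurable.
rewrite (density_integral (h := fun x => (W (lambda * `|x|))%:E) XfX); last 2 first.
  by apply/measurable_EFinP; exact: measurableT_comp.
  by move=> x; rewrite lee_fin.
have ml' : measurable_fun [set: R] (fun x => - ln (fX x / lambda)).
  apply: (measurableT_comp (@oppr_measurable R setT)).
  apply: measurableT_comp; first exact: measurable_ln.
  exact: measurable_funM.
apply: ge0_ae_eq_integral => //.
- apply/measurable_EFinP; apply: measurable_funM => //.
  exact: measurableT_comp.
- apply/measurable_EFinP; apply: measurable_funM => //.
  exact: measurableT_comp.
- by move=> x _; rewrite -EFinM lee_fin mulr_ge0.
- by move=> x _; rewrite lee_fin mulr_ge0.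
apply: lebesgue_aeS density_exponential_ae => x fE _; rewrite -EFinM fE.
congr EFin; have [x0|x0] := ltP x 0.
  by rewrite lt0_exponential_pdf// !mulr0.
rewrite exponential_pdfE// ger0_norm// [lambda * expR _]mulrC mulfK ?gt_eqF//.
by rewrite expRK mulNr opprK.
Qed.

Let mbound : measurable_fun [set: R] (fun x => 2 * lambda * K `|x|).
Proof.
apply: measurable_funM => //.
by apply: measurableT_comp; [exact: measurable_smooth|exact: normr_measurable].
Qed.

(** A density that takes only the values 0 and 2 lambda K|x| has, since
    fY x + fY (- x) > 0, the even part lambda K|x|; its total mass then forces
    2 K|x| = exp (- lambda |x|). *)
Lemma same_law_of_extremal_density :
  {ae mu, forall x, fY x = 0 \/ fY x = 2 * lambda * K `|x|} ->
  same_law P Y (\- X).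
Proof.
move=> ext.
have pos : {ae mu, forall x, 0 < fY x + fY (- x)}.
  exact: (density_mirror_gt0 lambda0 expX symXY YfY).
have ge : {ae mu, forall x, 2 * lambda * K `|x| <= fY x + fY (- x)}.
  have E2 : {ae mu, forall x, 2 * lambda * K `|x| <= fY x + fY (- x) \/ fY x = 0}.
    apply: lebesgue_aeS ext => x [->|->]; [by right|left].
    by rewrite lerDl.
  apply: lebesgue_aeS2 (lebesgue_aeS2 _ E2 (ae_opp E2)) pos => [x H|x]; last first.
    by move=> H1 H2; exact: (conj H1 H2).
  case: H => -[]; first by [].
  move=> fx0; rewrite opprK normrN addrC => -[//|fNx0].
  by rewrite fx0 fNx0 addr0 ltxx.
have mopp : measurable_fun [set: R] (-%R : R -> R) by exact: oppr_measurable.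
have even_integral (g : R -> R) : measurable_fun [set: R] g ->
    (forall x, 0 <= g x) -> (\int[mu]_x (g x)%:E = 1)%E ->
    (\int[mu]_x (g x + g (- x))%:E = 1 + 1)%E.
  move=> mg g0 g1; under eq_integral do rewrite EFinD.
  rewrite ge0_integralD//=; last 4 first.
  - by move=> x _; exact: g0.
  - exact/measurable_EFinP.
  - by move=> x _; exact: g0.
  - by apply/measurable_EFinP; exact: (measurableT_comp mg mopp).
  rewrite (@ge0_integral_opp R (fun x => (g x)%:E)) ?g1//.
    exact/measurable_EFinP.
have mpdf : measurable_fun [set: R] (exponential_pdf lambda).
  exact: measurable_exponential_pdf.
have pdf0 x : 0 <= exponential_pdf lambda x by rewrite exponential_pdf_ge0// ltW.
pose e2 x := exponential_pdf lambda x + exponential_pdf lambda (- x).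
have me2 : measurable_fun [set: R] e2.
  by apply: measurable_funD => //; exact: (measurableT_comp mpdf mopp).
have e2_int := even_integral _ mpdf pdf0 (integral_exponential_pdf lambda0).
have f2_int := even_integral _ mfY fY0 (density_integral1 YfY).
have e2E x : x != 0 -> e2 x = lambda * expR (- (lambda * `|x|)).
  rewrite /e2; have [x0 _|x0 _|->] // := ltgtP x 0.
  - rewrite lt0_exponential_pdf// add0r exponential_pdfE ?oppr_ge0 ?(ltW x0)//.
    by rewrite ltr0_norm// mulNr.
  - rewrite [X in _ + X]lt0_exponential_pdf ?oppr_lt0// addr0.
    by rewrite exponential_pdfE ?(ltW x0)// gtr0_norm// mulNr.
have ne0 : {ae mu, forall x : R, x != 0}.
  exists [set 0]; split; first exact: measurable_set1.
    exact: lebesgue_measure_set1.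
  by move=> x /= /negP; rewrite negbK => /eqP.
have eq_e2 : {ae mu, forall x, e2 x = 2 * lambda * K `|x|}.
  apply: ae_eq_of_integral_le => //.
  - by move=> x; rewrite addr_ge0.
  - apply: lebesgue_aeS ne0 => x /e2E ->; rewrite -mulrA mulrCA ler_pM2l//.
    exact: (smooth_ge_exp lambda0 expX symXY (normr_ge0 x)).
  - by rewrite e2_int ltry.
  rewrite e2_int -f2_int; apply: ae_ge0_le_integral => //.
  - move=> x _; rewrite lee_fin mulr_ge0 ?mulr_ge0 ?(ltW lambda0)//.
    exact: ltW.
  - exact/measurable_EFinP.
  - by move=> x _; rewrite lee_fin addr_ge0.
  - apply/measurable_EFinP; apply: measurable_funD => //.
    exact: (measurableT_comp mfY mopp).
  - by apply: lebesgue_aeS ge => x ?; rewrite lee_fin.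
have [_ symS] := symXY.
apply: (same_law_opp_of_abs symS).
- exact: (exponential_nonneg expX).
- exact: (exponential_sqr_integrable lambda0 expX).
move=> r r0; apply: ae_eq_nonincreasing.
- by move=> x y; exact: tail_le.
- by move=> x y; exact: tail_le.
- exact: cvg_tail_right.
- exact: cvg_tail_right.
apply: negligibleS eq_e2 => x /= [rx /eqP]; apply: contra_not.
have x0 : 0 < x by exact: le_lt_trans rx.
rewrite (tail_abs_exponential lambda0 expX symXY) ?(ltW x0)//.
rewrite (exponential_tail_abs lambda0 expX) ?(ltW x0)// e2E ?gt_eqF//.
rewrite gtr0_norm// => E; apply: (mulfI (lt0r_neq0 lambda0)).
by rewrite E; ring.
Qed.

End densities.
End exponential_integral_transform.

(** * Entropies of exponential symmetrizers *)

Section power_entropies.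
Context (R : realType).
Implicit Types (alpha : R) (a b : \bar R).
Local Open Scope ereal_scope.

(** Renyi and Tsallis entropies are order embeddings of the power integral,
    reversing the order when alpha > 1. *)
Lemma power_entropies alpha a b : alpha != 1%R -> 0 <= a -> 0 <= b ->
  (if (alpha < 1)%R then a <= b else b <= a) ->
  [/\ (1 - alpha)^-1%:E * lne a <= (1 - alpha)^-1%:E * lne b,
      ((1 - alpha)^-1%:E * lne b = (1 - alpha)^-1%:E * lne a <-> b = a),
      (1 - alpha)^-1%:E * (a - 1) <= (1 - alpha)^-1%:E * (b - 1) &
      ((1 - alpha)^-1%:E * (b - 1) = (1 - alpha)^-1%:E * (a - 1) <-> b = a)].
Proof.
move=> a1 a0 b0 ab.
have lneE (x y : \bar R) : 0 <= x -> 0 <= y -> (lne x <= lne y) = (x <= y).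
  by move=> x0 y0; rewrite lee_lne// in_itv/= leey andbT.
have subE (x y : \bar R) : (x - 1 <= y - 1) = (x <= y).
  by rewrite leeD2rE.
have embed (F : \bar R -> \bar R) :
    (forall x y, 0 <= x -> 0 <= y -> (F x <= F y) = (x <= y)) ->
    (1 - alpha)^-1%:E * F a <= (1 - alpha)^-1%:E * F b /\
    ((1 - alpha)^-1%:E * F b = (1 - alpha)^-1%:E * F a <-> b = a).
  move=> FE; have [lt1|gt1|E] := ltgtP alpha 1%R; last by rewrite E eqxx in a1.
    have c0 : (0 < (1 - alpha)^-1)%R by rewrite invr_gt0 subr_gt0.
    rewrite lt1 in ab; split; first by rewrite lee_pmul2l ?lte_fin// FE.
    split=> [E|->//]; apply/eqP; rewrite eq_le ab andbT.
    by rewrite -FE// -(@lee_pmul2l _ (1 - alpha)^-1%:E) ?lte_fin// E.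
  have c0 : ((1 - alpha)^-1 < 0)%R by rewrite invr_lt0 subr_lt0.
  have nmul x y : ((1 - alpha)^-1%:E * x <= (1 - alpha)^-1%:E * y) = (y <= x).
    by rewrite !leNgt lte_nmul2l ?lte_fin.
  rewrite ltNge (ltW gt1) /= in ab; split; first by rewrite nmul FE.
  split=> [E|->//]; apply/eqP; rewrite eq_le ab andTb.
  by rewrite -FE// -nmul E.
have [r1 r2] := embed _ lneE.
have [t1 t2] := embed (fun x => x - 1) (fun x y _ _ => subE x y).
by split.
Qed.

End power_entropies.

Section bounded_density.
Context d (T : measurableType d) (R : realType) (P : probability T R).
Variables (Z : {RV P >-> R}) (f : R -> R) (lambda : R).
Hypothesis Zf : is_density Z f.
Hypothesis lambda0 : 0 < lambda.
Local Notation mu := (@lebesgue_measure R).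
Hypothesis f_le : {ae mu, forall x, f x <= lambda}.

Let mf : measurable_fun [set: R] f. Proof. by case: Zf. Qed.
Let f0 x : 0 <= f x. Proof. by case: Zf. Qed.

(** The information - ln f, measured from its least possible value - ln lambda
    and weighted by f. The truncation at 0 changes it on a null set only, and
    makes it nonnegative everywhere. *)
Definition excess_information x := Num.max (- ln (f x / lambda)) 0 * f x.

Lemma measurable_excess_information : measurable_fun [set: R] excess_information.
Proof.
apply: measurable_funM => //; apply: measurable_maxr => //.
apply: (measurableT_comp (@oppr_measurable R setT)).
apply: measurableT_comp; first exact: measurable_ln.
exact: measurable_funM.
Qed.

Lemma excess_information_ge0 x : 0 <= excess_information x.
Proof. by rewrite mulr_ge0// le_max lexx orbT. Qed.

Local Open Scope ereal_scope.

(** Rewriting the entropy as a constant plus the integral of a nonnegative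
    function settles its existence, infinite values included. *)
Lemma shannon_excess :
  shannon f = (- ln lambda)%:E + \int[mu]_x (excess_information x)%:E.
Proof.
set u := excess_information; set l := ln lambda.
have mu_u := measurable_excess_information.
have mE : measurable_fun [set: R] (fun x => (u x)%:E) by exact/measurable_EFinP.
have u0 := excess_information_ge0.
have mlf : measurable_fun [set: R] (fun x => l * f x)%R by exact: measurable_funM.
have ilf : mu.-integrable [set: R] (EFin \o (fun x => l * f x)%R).
  rewrite (_ : _ \o _ = (fun x => l%:E * (EFin \o f) x))//.
  by apply: integrableZl => //; exact: (density_integrable Zf).
have lf_int : \int[mu]_x (l * f x)%:E = l%:E.
  under eq_integral do rewrite EFinM.
  rewrite integralZl//; last exact: (density_integrable Zf).
  by rewrite (density_integral1 Zf) mule1.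
have -> : shannon f = - \int[mu]_x (l * f x - u x)%:E.
  rewrite /shannon; congr (- _); apply: ae_eq_integral => //.
  - apply/measurable_EFinP; apply: measurable_funM => //.
    by apply: measurableT_comp => //; exact: measurable_ln.
  - by apply/measurable_EFinP; exact: measurable_funB.
  apply: lebesgue_aeS f_le => x fl _; congr EFin.
  rewrite /u /excess_information; have [fx0|fx0] := eqVneq (f x) 0%R.
    by rewrite fx0 mul0r !mulr0 subr0.
  have fp : (0 < f x)%R by rewrite lt_neqAle eq_sym fx0 f0.
  have lnE : (ln (f x / lambda) = ln (f x) - l)%R by rewrite ln_div ?posrE.
  rewrite max_l; last first.
    by rewrite oppr_ge0 ln_le0// ler_pdivrMr// mul1r.
  by rewrite lnE; ring.
have [uoo|] := ltP (\int[mu]_x (u x)%:E) +oo.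
  have iu : mu.-integrable [set: R] (EFin \o u).
    apply/integrableP; split => //.
    by under eq_integral do rewrite /= ger0_norm//.
  rewrite (_ : \int[mu]_x (l * f x - u x)%:E =
      \int[mu]_x ((EFin \o (fun x => l * f x)%R) \- (EFin \o u)) x)//.
  rewrite integralB// lf_int.
  have /fineK ufin : \int[mu]_x (u x)%:E \is a fin_num.
    exact: integrable_fin_num.
  rewrite -[X in _ - X]ufin -[X in _ = _ + X]ufin.
  move: (fine _) => r.
  by rewrite -EFinB -EFinN -EFinD; congr EFin; ring.
rewrite leye_eq => /eqP uoo; rewrite uoo addey//.
have mv : measurable_fun [set: R] (fun x => (l * f x - u x)%:E).
  by apply/measurable_EFinP; exact: measurable_funB.
pose lf x := `|l * f x|%R.
have mlf' : measurable_fun [set: R] (fun x => (lf x)%:E).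
  by apply/measurable_EFinP; exact: measurableT_comp.
have lfoo : \int[mu]_x (lf x)%:E < +oo by case/integrableP: ilf.
rewrite integralE.
have pos : \int[mu]_x (fun x => (l * f x - u x)%:E)^\+ x < +oo.
  apply: le_lt_trans lfoo; apply: ge0_le_integral => //.
    exact: measurable_funepos.
  move=> x _; rewrite funeposE -EFin_max lee_fin ge_max normr_ge0 andbT.
  by rewrite (le_trans _ (ler_norm _))// gerBl u0.
have neg : \int[mu]_x (fun x => (l * f x - u x)%:E)^\- x = +oo.
  apply/eqP; rewrite -leye_eq leNgt; apply/negP => negoo.
  have : \int[mu]_x (u x)%:E < +oo.
    apply: (@le_lt_trans _ _
      (\int[mu]_x ((fun x => (l * f x - u x)%:E)^\- x + (lf x)%:E))).
      apply: ge0_le_integral => //.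
      - by move=> x _; rewrite lee_fin.
      - apply: emeasurable_funD => //; exact: measurable_funeneg.
      - move=> x _; rewrite funenegE -EFinN -EFin_max -EFinD lee_fin.
        rewrite -lerBlDr le_max opprB lerD2l lerN2.
        by rewrite ler_norm.
    rewrite ge0_integralD//; [exact: lte_add_pinfty| |].
      exact: measurable_funeneg.
    by move=> x _; rewrite lee_fin normr_ge0.
  by rewrite uoo ltxx.
rewrite neg; have : \int[mu]_x (fun x => (l * f x - u x)%:E)^\+ x \is a fin_num.
  rewrite ge0_fin_numE//; apply: integral_ge0 => x _; exact: funepos_ge0.
by move=> /fineK <-.
Qed.

End bounded_density.

Section exponential_entropies.
Context d (T : measurableType d) (R : realType) (P : probability T R).
Variables (X Y : {RV P >-> R}) (lambda : R).
Hypothesis lambda0 : 0 < lambda.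
Hypothesis expX : exponential_rv X lambda.
Hypothesis symXY : independent_symmetrizer X Y.
Variables (fX fY : R -> R).
Hypothesis XfX : is_density X fX.
Hypothesis YfY : is_density Y fY.
Local Notation mu := (@lebesgue_measure R).
Local Notation K := (smooth Y lambda).
Local Notation L := (log_tail Y lambda).

Let mfY : measurable_fun [set: R] fY. Proof. by case: YfY. Qed.
Let fY0 x : 0 <= fY x. Proof. by case: YfY. Qed.
Let mfX : measurable_fun [set: R] fX. Proof. by case: XfX. Qed.
Let fX0 x : 0 <= fX x. Proof. by case: XfX. Qed.

Let mL : measurable_fun [set: R] L.
Proof. exact: (measurable_log_tail lambda0 expX symXY). Qed.

Let K0 x : 0 < K x.
Proof. exact: (smooth_gt0 lambda0 expX symXY). Qed.

Let expL x : lambda * expR (- L x) = 2 * lambda * K `|x|.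
Proof. by rewrite opprK lnK ?posrE ?mulr_gt0//; ring. Qed.

(** The density bound fY <= 2 lambda K|x|, read as a comparison of
    informations. *)
Let information_ge : {ae mu, forall x, fY x = 0 \/ L x <= - ln (fY x / lambda)}.
Proof.
apply: lebesgue_aeS (density_le_smooth lambda0 expX symXY YfY) => x.
have := fY0 x; rewrite le_eqVlt => /predU1P[<-|fx0 fxK]; first by left.
right; rewrite lerNr -[leRHS]expRK ler_ln ?posrE ?divr_gt0 ?expR_gt0//.
by rewrite ler_pdivrMr// mulrC expL.
Qed.

Let extremal x : fY x = 0 \/ L x = - ln (fY x / lambda) ->
  fY x = 0 \/ fY x = 2 * lambda * K `|x|.
Proof.
move=> [->|E]; first by left.
have := fY0 x; rewrite le_eqVlt => /predU1P[<-|fx0]; first by left.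
right; rewrite -expL E opprK lnK ?posrE ?divr_gt0//.
by field; rewrite gt_eqF.
Qed.

(** Equality in the comparison of informations, in the form in which the integrals
    deliver it: the density bound is attained wherever fY is positive. *)
Let equality_case (W : R -> R) : (forall s t, W s = W t -> s = t) ->
  {ae mu, forall x, W (L x) * fY x = W (- ln (fY x / lambda)) * fY x} ->
  same_law P Y (\- X).
Proof.
move=> Winj WE; apply: (same_law_of_extremal_density lambda0 expX symXY YfY).
apply: lebesgue_aeS WE => x WE; apply: extremal.
have [->|fx0] := eqVneq (fY x) 0; first by left.
by right; apply: Winj; exact: (mulIf fx0).
Qed.

Section power.
Variable alpha : R.
Hypothesis alpha0 : 0 < alpha.
Hypothesis alpha1 : alpha != 1.

(* the weight for which W (- ln u) u = u^alpha *)
Let W t : R := expR ((1 - alpha) * t).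

Let power_density u : 0 <= u ->
  W (- ln (u / lambda)) * u = lambda `^ (1 - alpha) * u `^ alpha.
Proof.
rewrite le_eqVlt => /predU1P[<-|u0]; first by rewrite powR0 ?gt_eqF// !mulr0.
rewrite /W /powR !gt_eqF// ln_div ?posrE// -{2}(lnK u0) -!expRD.
by congr expR; ring.
Qed.

Let mW : measurable_fun [set: R] W.
Proof. by apply: measurableT_comp => //; exact: mulrl_measurable. Qed.

Let c0 : 0 < lambda `^ (1 - alpha). Proof. exact: powR_gt0. Qed.

Let mpow (f : R -> R) : measurable_fun [set: R] f ->
  measurable_fun [set: R] (fun x => f x `^ alpha).
Proof. by move=> mf; exact: (measurableT_comp (measurable_powR _)). Qed.

Let scaled (f : R -> R) : measurable_fun [set: R] f -> (forall x, 0 <= f x) ->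
  (\int[mu]_x (W (- ln (f x / lambda)) * f x)%:E =
   (lambda `^ (1 - alpha))%:E * \int[mu]_x (f x `^ alpha)%:E)%E.
Proof.
move=> mf f0; under eq_integral do rewrite power_density// EFinM.
rewrite ge0_integralZl//=; last 2 first.
- by move=> x _; rewrite lee_fin powR_ge0.
- by rewrite lee_fin ltW.
by apply/measurable_EFinP; exact: mpow.
Qed.

Lemma exponential_power_finite : (\int[mu]_x (fX x `^ alpha)%:E < +oo)%E.
Proof.
have al0 : 0 < alpha * lambda by rewrite mulr_gt0.
rewrite (@ae_eq_integral _ (measurableTypeR R) R mu setT (fun x => ((lambda `^ alpha / (alpha * lambda)) *
   exponential_pdf (alpha * lambda) x)%:E))//.
- under eq_integral do rewrite EFinM.
  rewrite ge0_integralZl//=.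
  + by rewrite integral_exponential_pdf// mule1 ltry.
  + apply/measurable_EFinP; exact: measurable_exponential_pdf.
  + by move=> x _; rewrite lee_fin exponential_pdf_ge0// ltW.
  + by rewrite lee_fin divr_ge0 ?powR_ge0// ltW.
- by apply/measurable_EFinP; exact: mpow.
- apply/measurable_EFinP; apply: measurable_funM => //.
  exact: measurable_exponential_pdf.
apply: lebesgue_aeS (density_exponential_ae expX XfX) => x -> _.
congr EFin; have [x0|x0] := ltP x 0.
  by rewrite !lt0_exponential_pdf// powR0 ?gt_eqF// mulr0.
rewrite !exponential_pdfE// powRM ?expR_ge0 ?(ltW lambda0)//.
rewrite [expR (- lambda * x) `^ alpha]/powR gt_eqF ?expR_gt0// expRK.
have -> : alpha * (- lambda * x) = - (alpha * lambda) * x by ring.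
rewrite mulrA; congr (_ * _); rewrite divfK// gt_eqF//.
Qed.

Let mWL : measurable_fun [set: R] (fun x => W (L x) * fY x).
Proof. by apply: measurable_funM => //; exact: measurableT_comp. Qed.

Let mWY : measurable_fun [set: R] (fun x => W (- ln (fY x / lambda)) * fY x).
Proof.
rewrite (_ : (fun x => _) = (fun x => lambda `^ (1 - alpha) * fY x `^ alpha)).
  by apply: measurable_funM => //; exact: mpow.
by apply/funext => x; rewrite power_density.
Qed.

Let W_ge0 t : 0 <= W t. Proof. exact: expR_ge0. Qed.

Let intL : (\int[mu]_x (W (L x) * fY x)%:E =
  (lambda `^ (1 - alpha))%:E * \int[mu]_x (fX x `^ alpha)%:E)%E.
Proof.
rewrite -scaled//.
exact: (integral_log_tail lambda0 expX symXY XfX YfY mW W_ge0).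
Qed.

Let Winj s t : W s = W t -> s = t.
Proof.
by move=> /expR_inj/mulfI; apply; rewrite subr_eq0 eq_sym.
Qed.

Let weighted_le : alpha < 1 -> {ae mu, forall x,
  W (L x) * fY x <= W (- ln (fY x / lambda)) * fY x}.
Proof.
move=> a1; apply: lebesgue_aeS information_ge => x [->|LE].
  by rewrite !mulr0 lexx.
apply: ler_wpM2r; first exact: fY0.
by rewrite ler_expR ler_pM2l ?subr_gt0.
Qed.

Let weighted_ge : 1 <= alpha -> {ae mu, forall x,
  W (- ln (fY x / lambda)) * fY x <= W (L x) * fY x}.
Proof.
move=> a1; apply: lebesgue_aeS information_ge => x [->|LE].
  by rewrite !mulr0 lexx.
apply: ler_wpM2r; first exact: fY0.
by rewrite ler_expR ler_wnM2l ?subr_le0.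
Qed.

Let W_mul_ge0 (g : R -> R) x : 0 <= W (g x) * fY x.
Proof. by apply: mulr_ge0; [exact: W_ge0|exact: fY0]. Qed.

Lemma exponential_power_le : (if (alpha < 1)%R
  then \int[mu]_x (fX x `^ alpha)%:E <= \int[mu]_x (fY x `^ alpha)%:E
  else \int[mu]_x (fY x `^ alpha)%:E <= \int[mu]_x (fX x `^ alpha)%:E)%E.
Proof.
have scale (x y : \bar R) : (x <= y)%E =
    ((lambda `^ (1 - alpha))%:E * x <= (lambda `^ (1 - alpha))%:E * y)%E.
  by rewrite lee_pmul2l ?lte_fin.
have mWL' := (measurable_EFinP _ _).2 mWL.
have mWY' := (measurable_EFinP _ _).2 mWY.
case: ltP => a1; rewrite scale.
- rewrite -intL -(scaled mfY fY0); apply: ae_ge0_le_integral => //.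
  + by move=> x _; rewrite lee_fin (W_mul_ge0 L).
  + by move=> x _; rewrite lee_fin (W_mul_ge0 (fun x => - ln (fY x / lambda))).
  + by apply: lebesgue_aeS (weighted_le a1) => x ? _; rewrite lee_fin.
- rewrite -intL -(scaled mfY fY0); apply: ae_ge0_le_integral => //.
  + by move=> x _; rewrite lee_fin (W_mul_ge0 (fun x => - ln (fY x / lambda))).
  + by move=> x _; rewrite lee_fin (W_mul_ge0 L).
  + by apply: lebesgue_aeS (weighted_ge a1) => x ? _; rewrite lee_fin.
Qed.

Lemma exponential_power_eq :
  (\int[mu]_x (fY x `^ alpha)%:E = \int[mu]_x (fX x `^ alpha)%:E)%E ->
  same_law P Y (\- X).
Proof.
move=> IE; apply: (equality_case Winj).
have EI : (\int[mu]_x (W (- ln (fY x / lambda)) * fY x)%:E =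
    \int[mu]_x (W (L x) * fY x)%:E)%E.
  rewrite intL (scaled mfY fY0) IE; reflexivity.
have Loo : (\int[mu]_x (W (L x) * fY x)%:E < +oo)%E.
  rewrite intL; apply: lte_mul_pinfty; first by rewrite lee_fin ltW.
    exact: isT.
  exact: exponential_power_finite.
have [a1|a1] := ltP alpha 1.
- apply: ae_eq_of_integral_le.
  + exact: mWL.
  + exact: mWY.
  + exact: (W_mul_ge0 L).
  + exact: weighted_le.
  + exact: Loo.
  + rewrite EI; exact: lexx.
- have WE : {ae mu, forall x, W (- ln (fY x / lambda)) * fY x = W (L x) * fY x}.
    apply: ae_eq_of_integral_le.
    + exact: mWY.
    + exact: mWL.
    + exact: (W_mul_ge0 (fun x => - ln (fY x / lambda))).
    + exact: weighted_ge.
    + rewrite EI; exact: Loo.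
    + rewrite EI; exact: lexx.
  by apply: lebesgue_aeS WE => x ->.
Qed.

End power.

Let Lge0 x : 0 <= L x.
Proof. exact: (log_tail_ge0 lambda0 expX symXY). Qed.

Let fY_lambda : {ae mu, forall x, fY x <= lambda}.
Proof.
apply: lebesgue_aeS (density_le_smooth lambda0 expX symXY YfY) => x.
move=> /le_trans; apply; rewrite -expL ler_piMr ?(ltW lambda0)//.
by rewrite -[leRHS]expR0 ler_expR oppr_le0.
Qed.

Let fX_lambda : {ae mu, forall x, fX x <= lambda}.
Proof.
apply: lebesgue_aeS (density_exponential_ae expX XfX) => x ->.
have [x0|x0] := ltP x 0; first by rewrite lt0_exponential_pdf// ltW.
rewrite exponential_pdfE// ler_piMr ?(ltW lambda0)//.
by rewrite -[leRHS]expR0 ler_expR mulNr oppr_le0 mulr_ge0// ltW.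
Qed.

Let intL1 : (\int[mu]_x (L x * fY x)%:E =
  \int[mu]_x (excess_information fX lambda x)%:E)%E.
Proof.
have mm : measurable_fun [set: R] (fun t : R => Num.max t 0).
  by apply: measurable_maxr.
rewrite -(integral_log_tail lambda0 expX symXY XfX YfY mm); last first.
  by move=> t; rewrite le_max lexx orbT.
by apply: eq_integral => x _; rewrite max_l.
Qed.

Let mLf : measurable_fun [set: R] (fun x => L x * fY x).
Proof. exact: measurable_funM. Qed.

Let mexcess : measurable_fun [set: R] (excess_information fY lambda).
Proof. exact: (measurable_excess_information lambda YfY). Qed.

Let excess_ge : {ae mu, forall x, L x * fY x <= excess_information fY lambda x}.
Proof.
apply: lebesgue_aeS information_ge => x [fx0|LE].
  by rewrite /excess_information fx0 !mulr0.
by rewrite /excess_information ler_wpM2r// le_max LE.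
Qed.

Lemma exponential_shannon_le : (shannon fX <= shannon fY)%E.
Proof.
rewrite (shannon_excess XfX lambda0 fX_lambda).
rewrite (shannon_excess YfY lambda0 fY_lambda) leeD2lE//.
rewrite -intL1; apply: ae_ge0_le_integral => //.
- by move=> x _; rewrite lee_fin mulr_ge0.
- exact/measurable_EFinP.
- by move=> x _; rewrite lee_fin (excess_information_ge0 lambda YfY).
- exact/measurable_EFinP.
- by apply: lebesgue_aeS excess_ge => x; rewrite lee_fin.
Qed.

Lemma exponential_shannon_finite :
  (\int[mu]_x (excess_information fX lambda x)%:E < +oo)%E.
Proof.
have : P.-integrable [set: T] (EFin \o X).
  apply: integrable_of_sqr; exact: (exponential_sqr_integrable lambda0 expX).
move=> /integrableP[_].
have mh : measurable_fun [set: R] (fun x : R => (`|x|)%:E).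
  by apply/measurable_EFinP; exact: normr_measurable.
rewrite (density_integral (h := fun x => (`|x|)%:E) XfX)// => Xoo.
apply: (@le_lt_trans _ _ (lambda%:E * \int[mu]_x (`|x|%:E * (fX x)%:E))%E); last first.
  by rewrite lte_mul_pinfty// lee_fin ltW.
rewrite -ge0_integralZl//=; last 3 first.
- by apply: emeasurable_funM => //; exact/measurable_EFinP.
- by move=> x _; rewrite -EFinM lee_fin mulr_ge0.
- by rewrite lee_fin ltW.
apply: ae_ge0_le_integral => //.
- by move=> x _; rewrite lee_fin (excess_information_ge0 lambda XfX).
- apply/measurable_EFinP; exact: (measurable_excess_information lambda XfX).
- by move=> x _; rewrite -!EFinM lee_fin mulr_ge0// ?mulr_ge0// ltW.
- apply: measurable_funeM.
  by apply: emeasurable_funM => //; exact/measurable_EFinP.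
apply: lebesgue_aeS (density_exponential_ae expX XfX) => x fE _.
rewrite -!EFinM lee_fin mulrA /excess_information ler_wpM2r// fE.
rewrite ge_max mulr_ge0 ?(ltW lambda0)// andbT.
have [x0|x0] := ltP x 0.
  by rewrite lt0_exponential_pdf// mul0r ln0// oppr0 mulr_ge0 ?(ltW lambda0).
rewrite exponential_pdfE// ger0_norm// [lambda * expR _]mulrC mulfK ?gt_eqF//.
by rewrite expRK mulNr opprK.
Qed.

Lemma exponential_shannon_eq : shannon fY = shannon fX -> same_law P Y (\- X).
Proof.
rewrite (shannon_excess XfX lambda0 fX_lambda).
rewrite (shannon_excess YfY lambda0 fY_lambda) => /eqP.
rewrite eq_le !leeD2lE// -eq_le => /eqP E.
apply: (equality_case (W := idfun)) => //=.
have : {ae mu, forall x, L x * fY x = excess_information fY lambda x}.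
  apply: ae_eq_of_integral_le => //.
  - by move=> x; rewrite mulr_ge0.
  - by rewrite intL1 exponential_shannon_finite.
  - by rewrite intL1 E.
move=> H; apply: lebesgue_aeS2 H information_ge => x.
move=> H [->|LE]; first by rewrite !mulr0.
by rewrite H /excess_information max_l// (le_trans _ LE).
Qed.

(** If Y has the law of -X, the densities are mirror images. *)
Let mirror_density : same_law P Y (\- X) ->
  {ae mu, forall x, fY x = fX (- x)}.
Proof.
move=> law; apply: (density_ae_unique YfY).
  exact: (measurableT_comp mfX (@oppr_measurable R setT)).
move=> A mA.
have mNA : measurable (-%R @^-1` A : set R).
  by rewrite -[X in measurable X]setTI; apply: oppr_measurable.
rewrite [LHS]law// -[LHS]/(distribution P X (-%R @^-1` A)).
case: XfX => _ _ -> //.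
rewrite integral_mkcond [RHS]integral_mkcond.
rewrite -ge0_integral_opp; last 2 first.
- apply/(measurable_restrictT _ _).1 => //; apply/measurable_EFinP.
  exact: measurable_funTS.
- by move=> x; rewrite patchE; case: ifP => // _; rewrite lee_fin.
apply: eq_integral => x _; rewrite !patchE.
suff -> : (- x \in -%R @^-1` A) = (x \in A) by [].
by apply/idP/idP; rewrite !inE /= opprK.
Qed.

Lemma exponential_power_mirror alpha : same_law P Y (\- X) ->
  (\int[mu]_x (fY x `^ alpha)%:E = \int[mu]_x (fX x `^ alpha)%:E)%E.
Proof.
move=> /mirror_density fE.
have mX : measurable_fun [set: R] (fun x => (fX x `^ alpha)%:E).
  by apply/measurable_EFinP; exact: (measurableT_comp (measurable_powR _)).
rewrite -(ge0_integral_opp mX); last by move=> x; rewrite lee_fin powR_ge0.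
apply: ae_eq_integral => //.
- by apply/measurable_EFinP; exact: (measurableT_comp (measurable_powR _)).
- exact: (measurableT_comp mX (@oppr_measurable R setT)).
- by apply: lebesgue_aeS fE => x ->.
Qed.

Lemma exponential_shannon_mirror : same_law P Y (\- X) -> shannon fY = shannon fX.
Proof.
move=> /mirror_density fE.
rewrite (shannon_excess XfX lambda0 fX_lambda).
rewrite (shannon_excess YfY lambda0 fY_lambda); congr (_ + _)%E.
have mX : measurable_fun [set: R] (fun x => (excess_information fX lambda x)%:E).
  apply/measurable_EFinP; exact: (measurable_excess_information lambda XfX).
rewrite -(ge0_integral_opp mX); last first.
  by move=> x; rewrite lee_fin (excess_information_ge0 lambda XfX).
apply: ae_eq_integral => //.
- exact/measurable_EFinP.
- exact: (measurableT_comp mX (@oppr_measurable R setT)).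
- by apply: lebesgue_aeS fE => x fx _; rewrite /excess_information fx.
Qed.

Lemma exponential_entropies alpha : 0 < alpha ->
  [/\ (renyi alpha fX <= renyi alpha fY)%E,
      (renyi alpha fY = renyi alpha fX <-> same_law P Y (\- X)),
      (tsallis alpha fX <= tsallis alpha fY)%E &
      (tsallis alpha fY = tsallis alpha fX <-> same_law P Y (\- X))].
Proof.
move=> a0; rewrite /renyi /tsallis; case: eqVneq => [_|a1].
  have le := exponential_shannon_le.
  have eq : shannon fY = shannon fX <-> same_law P Y (\- X).
    split; [exact: exponential_shannon_eq|exact: exponential_shannon_mirror].
  by split.
have int0 (f : R -> R) : (0 <= \int[mu]_x (f x `^ alpha)%:E)%E.
  by apply: integral_ge0 => x _; rewrite lee_fin powR_ge0.
have [r1 r2 t1 t2] := power_entropies a1 (int0 fX) (int0 fY)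
  (exponential_power_le a0).
have eq : (\int[mu]_x (fY x `^ alpha)%:E = \int[mu]_x (fX x `^ alpha)%:E)%E <->
    same_law P Y (\- X).
  split; [exact: (exponential_power_eq a0 a1)|exact: exponential_power_mirror].
split; [exact: r1|exact: (iff_trans r2 eq)|exact: t1|exact: (iff_trans t2 eq)].
Qed.

End exponential_entropies.

(** * Sums over sequences of bounded hazard *)

Section value_function.
Context (R : realType) (q : R).
Hypothesis q01 : 0 < q < 1.
Implicit Types (phi Phi : R -> R) (theta t m : R).

(** Phi m is the sum of phi over the masses (1 - q) q^k m of a geometric law of
    total mass m: the value function of the problem of minimizing a sum of values
    of phi when at most a fraction 1 - q of the remaining mass is spent at each
    step. The second and fourth conditions are the traces of concavity that the
    proof uses; phi t is t^alpha, - t^alpha or - t ln t below. *)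
Definition value_function phi Phi := [/\ phi 0 = 0,
  (forall theta t, 0 < theta < 1 -> 0 < t -> theta * phi t < phi (theta * t)),
  (forall m, 0 < m -> Phi m = phi ((1 - q) * m) + Phi (q * m)),
  (forall theta m, 0 < theta < 1 -> 0 < m ->
     theta * Phi (q * m) + (1 - theta) * Phi m
     <= Phi ((theta * q + (1 - theta)) * m)) &
  Phi t @[t --> 0^'+] --> (0 : R)].

Variables phi Phi : R -> R.
Hypothesis V : value_function phi Phi.

Lemma value_function_subadditive a b : 0 <= a -> 0 <= b ->
  phi (a + b) <= phi a + phi b.
Proof.
case: V => phi0 star _ _ _.
rewrite le_eqVlt => /predU1P[<-|a0]; first by rewrite add0r phi0 add0r.
rewrite le_eqVlt => /predU1P[<-|b0]; first by rewrite addr0 phi0 addr0.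
have s0 : 0 < a + b by rewrite addr_gt0.
have th (x y : R) : 0 < x -> 0 < y -> 0 < x / (x + y) < 1.
  move=> x0 y0; have xy : 0 < x + y by rewrite addr_gt0.
  by rewrite divr_gt0//= ltr_pdivrMr// mul1r ltrDl.
have := star _ (a + b) (th b a b0 a0); rewrite (addrC b a) => /(_ s0).
have := star _ _ (th a b a0 b0) s0.
rewrite !divfK ?gt_eqF// => A B.
have E : phi (a + b) = a / (a + b) * phi (a + b) + b / (a + b) * phi (a + b).
  by rewrite -mulrDl -mulrDl divff ?gt_eqF// mul1r.
by rewrite E; apply: lerD; exact: ltW.
Qed.

(** The map m' |-> phi (m - m') + Phi m' takes the value Phi m at m' = q m and at
    m' = m, and is strictly concave. *)
Lemma value_function_step m (m' : R) : 0 < m -> q * m <= m' < m ->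
  Phi m <= phi (m - m') + Phi m' ?= iff (m' == q * m).
Proof.
move=> m0 /andP[qm m'm]; have [_ star rec conc _] := V.
have [q0 q1] : 0 < q /\ q < 1 by apply/andP.
have p0 : 0 < 1 - q by rewrite subr_gt0.
have [->|neq] := eqVneq m' (q * m).
  rewrite rec// (_ : m - q * m = (1 - q) * m); last by ring.
  by split; rewrite ?lexx ?eqxx.
suff lt : Phi m < phi (m - m') + Phi m' by split; [exact: ltW|rewrite lt_eqF].
have qm' : q * m < m' by rewrite lt_neqAle eq_sym neq.
have pm0 : 0 < (1 - q) * m by rewrite mulr_gt0.
pose theta := (m - m') / ((1 - q) * m).
have th : 0 < theta < 1.
  rewrite divr_gt0 ?subr_gt0//= ltr_pdivrMr// mul1r.
  by rewrite mulrBl mul1r ltrD2l ltrN2.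
have mE : m - m' = theta * ((1 - q) * m) by rewrite divfK// gt_eqF.
have m'E : m' = (theta * q + (1 - theta)) * m.
  have -> : (theta * q + (1 - theta)) * m = m - theta * ((1 - q) * m) by ring.
  by rewrite -mE; ring.
have H1 := star _ _ th pm0; have H2 := conc _ _ th m0.
rewrite -mE in H1; rewrite -m'E in H2.
have H3 : Phi m = theta * phi ((1 - q) * m) +
    (theta * Phi (q * m) + (1 - theta) * Phi m).
  rewrite addrA -mulrDr -rec//; ring.
by rewrite H3; apply: ltr_leD.
Qed.

Section sequence.
Variable D : nat -> R.
Hypothesis D0 : D 0%N = 1.
Hypothesis Dq : forall n, q * D n <= D n.+1.
Hypothesis Dlt : forall n, D n.+1 < D n.
Hypothesis D_cvg : D n @[n --> \oo] --> (0 : R).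

Lemma remaining_mass_gt0 n : 0 < D n.
Proof.
have [q0 _] : 0 < q /\ q < 1 by apply/andP.
elim: n => [|n IH]; first by rewrite D0.
by apply: lt_le_trans (Dq n); rewrite mulr_gt0.
Qed.

Let step n := value_function_step (remaining_mass_gt0 n)
  (introT andP (conj (Dq n) (Dlt n))).

Let defect n := phi (D n - D n.+1) + Phi (D n.+1) - Phi (D n).

Let defect_ge0 n : 0 <= defect n.
Proof. by rewrite subr_ge0 (step n). Qed.

Let S N := \sum_(n < N) phi (D n - D n.+1).

Let partial_ge k N : Phi 1 + (if (k < N)%N then defect k else 0) <= S N + Phi (D N).
Proof.
elim: N => [|N IH]; first by rewrite /S big_ord0 D0 addr0 add0r.
have -> : S N.+1 + Phi (D N.+1) = S N + Phi (D N) + defect N.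
  by rewrite /S big_ord_recr /= /defect; ring.
rewrite ltnS leq_eqVlt; case: eqVneq => [->|_] /= in IH *.
  by rewrite ltnn addr0 in IH; rewrite lerD2r.
by apply: (le_trans IH); rewrite lerDl.
Qed.

Lemma value_function_partial N : Phi 1 <= S N + Phi (D N).
Proof. by have := partial_ge N N; rewrite ltnn addr0. Qed.

Let Phi_cvg : Phi (D n) @[n --> \oo] --> (0 : R).
Proof.
have [_ _ _ _ /cvg_at_rightP] := V; apply; split => //.
exact: remaining_mass_gt0.
Qed.

(** A step at less than the full rate loses a positive amount for good. *)
Lemma value_function_limit l : S N @[N --> \oo] --> l ->
  Phi 1 <= l /\ (l = Phi 1 -> forall n, D n.+1 = q * D n).
Proof.
move=> Sl.
have Sl' : S N + Phi (D N) @[N --> \oo] --> l.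
  by rewrite -[l]addr0; apply: cvgD.
have ge k : Phi 1 + defect k <= l.
  apply: (cvgr_to_ge Sl'); exists k.+1 => // N /= kN.
  by have := partial_ge k N; rewrite kN.
split; first by apply: le_trans (ge 0%N); rewrite lerDl.
move=> lE n; apply/eqP; rewrite -(step n) eq_sym -subr_eq0 -/(defect n).
by rewrite eq_le defect_ge0 andbT; have := ge n; rewrite lE gerDl.
Qed.

End sequence.

Lemma value_function_geometric :
  \sum_(n < N) phi (q ^+ n - q ^+ n.+1) @[N --> \oo] --> Phi 1.
Proof.
have [q0 q1] : 0 < q /\ q < 1 by apply/andP.
have E N : \sum_(n < N) phi (q ^+ n - q ^+ n.+1) = Phi 1 - Phi (q ^+ N).
  elim: N => [|N IH]; first by rewrite big_ord0 expr0 subrr.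
  have [_ _ rec _ _] := V.
  rewrite big_ord_recr /= IH (rec (q ^+ N)) ?exprn_gt0// -exprS.
  by rewrite (_ : q ^+ N - q ^+ N.+1 = (1 - q) * q ^+ N); [ring|rewrite exprS; ring].
rewrite (funext E) -[X in _ --> X]subr0; apply: cvgB; first exact: cvg_cst.
have [_ _ _ _ /cvg_at_rightP] := V; apply; split => [n|].
  by rewrite exprn_gt0.
by apply: cvg_expr; rewrite ger0_norm// ltW.
Qed.

End value_function.

Section power_value_function.
Context (R : realType).
Implicit Types alpha theta x y t m q : R.

Lemma powR_convex alpha theta x y : 1 <= alpha -> 0 <= theta <= 1 ->
  0 <= x -> 0 <= y ->
  (theta * x + (1 - theta) * y) `^ alpha <=
  theta * x `^ alpha + (1 - theta) * y `^ alpha.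
Proof.
move=> a1 /andP[t0 t1] x0 y0.
by apply: (@convex_powR R alpha a1 (Itv01 t0 t1) x y);
  rewrite inE /= in_itv/= andbT.
Qed.

(** Convexity of the inverse power. *)
Lemma powR_concave alpha theta x y : 0 < alpha <= 1 -> 0 <= theta <= 1 ->
  0 <= x -> 0 <= y ->
  theta * x `^ alpha + (1 - theta) * y `^ alpha <=
  (theta * x + (1 - theta) * y) `^ alpha.
Proof.
move=> /andP[a0 a1] th x0 y0; have /andP[t0 t1] := th.
have ai : 1 <= alpha^-1 by rewrite invf_ge1.
have invK u : 0 <= u -> (u `^ alpha) `^ alpha^-1 = u.
  by move=> u0; rewrite -powRrM divff ?gt_eqF// powRr1.
have invK' u : 0 <= u -> (u `^ alpha^-1) `^ alpha = u.
  by move=> u0; rewrite -powRrM mulVf ?gt_eqF// powRr1.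
have comb u v : 0 <= u -> 0 <= v -> 0 <= theta * u + (1 - theta) * v.
  by move=> u0 v0; rewrite addr_ge0// mulr_ge0// subr_ge0.
have := powR_convex ai th (powR_ge0 x alpha) (powR_ge0 y alpha).
rewrite !invK// => H.
rewrite -[leLHS]invK'; last by apply: comb; exact: powR_ge0.
apply: ge0_ler_powR H; rewrite ?nnegrE ?powR_ge0 ?comb//.
exact: ltW.
Qed.

Lemma powR_gt_id alpha theta : alpha < 1 -> 0 < theta < 1 ->
  theta < theta `^ alpha.
Proof.
move=> a1 /andP[t0 t1]; rewrite /powR gt_eqF// -[ltLHS]lnK ?posrE// ltr_expR.
have : ln theta < 0 by rewrite ln_lt0// t0.
by move=> l0; nra.
Qed.

Lemma powR_lt_id alpha theta : 1 < alpha -> 0 < theta < 1 ->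
  theta `^ alpha < theta.
Proof.
move=> a1 /andP[t0 t1]; rewrite /powR gt_eqF// -[ltRHS]lnK ?posrE// ltr_expR.
have : ln theta < 0 by rewrite ln_lt0// t0.
by move=> l0; nra.
Qed.

Variables q alpha : R.
Hypothesis q01 : 0 < q < 1.
Hypothesis alpha0 : 0 < alpha.

Let c := (1 - q) `^ alpha / (1 - q `^ alpha).

Let q0 : 0 < q. Proof. by case/andP: q01. Qed.
Let p0 : 0 < 1 - q. Proof. by rewrite subr_gt0; case/andP: q01. Qed.

Let powq_lt1 : 0 < 1 - q `^ alpha.
Proof.
rewrite subr_gt0 /powR gt_eqF// -[ltRHS]expR0 ltr_expR pmulr_rlt0//.
by rewrite ln_lt0.
Qed.

Let c0 : 0 < c. Proof. by rewrite divr_gt0// powR_gt0. Qed.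

Let step_power m : 0 < m ->
  c * m `^ alpha = ((1 - q) * m) `^ alpha + c * (q * m) `^ alpha.
Proof.
move=> m0; rewrite !powRM ?(ltW m0) ?(ltW p0) ?(ltW q0)// /c.
by field; rewrite gt_eqF.
Qed.

Let power_at0 : c * t `^ alpha @[t --> 0^'+] --> (0 : R).
Proof. by rewrite -[X in _ --> X](mulr0 c); apply: cvgMr; exact: powR_cvg0. Qed.

Let combE theta m : (theta * q + (1 - theta)) * m = theta * (q * m) + (1 - theta) * m.
Proof. by ring. Qed.

Lemma power_value_function_lt1 : alpha < 1 ->
  value_function q (fun t => t `^ alpha) (fun t => c * t `^ alpha).
Proof.
move=> a1; split => //.
- by rewrite powR0// gt_eqF.
- move=> theta t th t0; have /andP[th0 _] := th.
  by rewrite powRM ?ltW// ltr_pM2r ?powR_gt0// powR_gt_id.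
- move=> theta m /andP[/ltW th0 /ltW th1] m0; rewrite combE.
  have -> a b : theta * (c * a) + (1 - theta) * (c * b) =
    c * (theta * a + (1 - theta) * b) by ring.
  rewrite ler_pM2l//.
  by apply: powR_concave; rewrite ?alpha0 ?th0 ?th1 ?mulr_ge0 ?(ltW a1) ?ltW.
Qed.

Lemma power_value_function_gt1 : 1 < alpha ->
  value_function q (fun t => - t `^ alpha) (fun t => - (c * t `^ alpha)).
Proof.
move=> a1; split => //.
- by rewrite powR0 ?oppr0// gt_eqF.
- move=> theta t th t0; have /andP[th0 _] := th.
  by rewrite mulrN ltrN2 powRM ?ltW// ltr_pM2r ?powR_gt0// powR_lt_id.
- by move=> m m0; rewrite step_power// opprD.
- move=> theta m /andP[/ltW th0 /ltW th1] m0; rewrite combE.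
  have -> a b : theta * - (c * a) + (1 - theta) * - (c * b) =
    - (c * (theta * a + (1 - theta) * b)) by ring.
  rewrite lerN2 ler_pM2l//.
  by apply: powR_convex; rewrite ?th0 ?th1 ?mulr_ge0 ?(ltW a1) ?ltW.
- by rewrite -[X in _ --> X]oppr0; apply: cvgN.
Qed.

Lemma power_value_function_le0 t : - (c * t `^ alpha) <= 0.
Proof. by rewrite oppr_le0 mulr_ge0 ?powR_ge0 ?ltW. Qed.

End power_value_function.

Section shannon_value_function.
Context (R : realType).
Implicit Types x t m theta : R.

Lemma ln_ge_1BV x : 0 < x -> 1 - x^-1 <= ln x.
Proof.
move=> x0; rewrite -[leRHS]opprK -lnV ?posrE// lerNr opprB.
have := @le_ln1Dx R (x^-1 - 1); rewrite addrCA subrr addr0; apply.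
by rewrite ltrBrDl subrr invr_gt0.
Qed.

Lemma cvg_xlnx0 : - (t * ln t) @[t --> 0^'+] --> (0 : R).
Proof.
have half0 : 0 < 2^-1 :> R by rewrite invr_gt0.
apply: (@squeeze_cvgr _ _ _ _ (cst 0) (fun t => 2 * t `^ 2^-1)).
- near=> t; have t0 : 0 < t by [].
  have t1 : t < 1 by near: t; apply: nbhs_right_lt.
  rewrite oppr_ge0 pmulr_rle0// ln_le0 ?(ltW t1)//=.
  pose s := t `^ 2^-1; have s0 : 0 < s by exact: powR_gt0.
  have tE : t = s * s.
    rewrite -powRD; last by rewrite [t == 0]gt_eqF ?implybT.
    by rewrite (_ : 2^-1 + 2^-1 = 1) ?powRr1 ?ltW//; lra.
  rewrite -/s tE lnM ?posrE//.
  have := @ln_sublinear R s^-1; rewrite invr_gt0 => /(_ s0).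
  rewrite lnV ?posrE// => H.
  have sV : s * s^-1 = 1 by rewrite divff// gt_eqF.
  rewrite (_ : - (s * s * (ln s + ln s)) = 2 * (s * (s * - ln s))); last by ring.
  rewrite ler_pM2l// -[leRHS]mulr1 -sV ler_pM2l// ler_pM2l//.
  exact: ltW.
- exact: cvg_cst.
- by rewrite -[X in _ --> X](mulr0 (2 : R)); apply: cvgMr; exact: powR_cvg0.
Unshelve. all: by end_near. Qed.

Variable q : R.
Hypothesis q01 : 0 < q < 1.

(** The constant is the entropy of the geometric law. *)
Definition geometric_entropy : R :=
  - ((1 - q) * ln (1 - q) + q * ln q) / (1 - q).

Lemma shannon_value_function : value_function q (fun t => - (t * ln t))
  (fun t => - (t * ln t) + geometric_entropy * t).
Proof.
have /andP[q0 q1] := q01; have p0 : 0 < 1 - q by rewrite subr_gt0.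
split.
- by rewrite mul0r oppr0.
- move=> theta t /andP[th0 th1] t0; rewrite lnM ?posrE//.
  have l0 : ln theta < 0 by rewrite ln_lt0// th0.
  rewrite -subr_gt0 (_ : _ - _ = theta * t * - ln theta); last by ring.
  by rewrite !mulr_gt0// oppr_gt0.
- move=> m m0; rewrite !lnM ?posrE// /geometric_entropy.
  by field; rewrite gt_eqF.
- move=> theta m /andP[th0 th1] m0.
  set r := theta * q + (1 - theta).
  have r0 : 0 < r by rewrite addr_gt0 ?mulr_gt0// subr_gt0.
  rewrite !lnM ?posrE//.
  have A : q * ln r + q - r <= q * ln q.
    have := ln_ge_1BV (divr_gt0 q0 r0); rewrite ln_div ?posrE// invf_div => H.
    have E : q * (r / q) = r by rewrite mulrC divfK// gt_eqF.
    by move: H; rewrite -(ler_pM2l q0) mulrBr E; lra.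
  have B : ln r + 1 - r <= 0.
    have := ln_ge_1BV (divr_gt0 (ltr01 : 0 < 1 :> R) r0).
    by rewrite ln_div ?posrE// ln1 invf_div divr1; lra.
  have C : r * ln r <= theta * (q * ln q).
    have A' : theta * (q * ln r + q - r) <= theta * (q * ln q).
      by rewrite ler_pM2l.
    have B' : (1 - theta) * (ln r + 1 - r) <= 0.
      by rewrite pmulr_rle0// subr_gt0.
    apply: le_trans A'; apply: le_trans (_ : theta * (q * ln r + q - r) + (1 - theta) * (ln r + 1 - r) <= _); last by rewrite gerDl.
    by rewrite /r; lra.
  have D : m * (r * ln r) <= m * (theta * (q * ln q)) by rewrite ler_pM2l.
  rewrite -subr_ge0; move: D; rewrite -subr_ge0 => D.
  apply: le_trans D _; rewrite le_eqVlt; apply/orP; left; apply/eqP.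
  by rewrite /r; ring.
- rewrite -[X in _ --> X](addr0 (0 : R)); apply: cvgD; first exact: cvg_xlnx0.
  rewrite -[X in _ --> X](mulr0 geometric_entropy); apply: cvgMr.
  by apply: cvg_at_right_filter; exact: cvg_id.
Qed.

End shannon_value_function.

(** * Symmetrizers of a geometric variable *)

Section integer_valued.
Context d (T : measurableType d) (R : realType) (P : probability T R).
Variable Z : {RV P >-> R}.
Hypothesis intZ : integer_valued Z.
Implicit Types (k n : int) (r : R).

Lemma prob_ae_eq (A B : set T) : measurable A -> measurable B ->
  {ae P, forall w, A w <-> B w} -> P A = P B.
Proof.
move=> mA mB [N [mN N0 sub]].
have le (C E : set T) : measurable C -> measurable E ->
    (forall w, ~ N w -> C w -> E w) -> (P C <= P E)%E.
  move=> mC mE CE; rewrite -[leRHS]adde0 -[X in (_ <= _ + X)%E]N0.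
  apply: le_trans (measureU2 _ mE mN); apply: le_measure; rewrite ?inE//.
    exact: measurableU.
  by move=> w Cw; have [Nw|Nw] := pselect (N w); [right|left; exact: CE].
have AB w : ~ N w -> (A w <-> B w) by move=> Nw; apply: contrapT => /sub.
apply/eqP; rewrite eq_le; apply/andP; split; apply: le => // w /AB AB' ?;
  exact/AB'.
Qed.

Lemma integer_tail_floor r : tail Z r = tail Z (Num.floor r)%:~R.
Proof.
apply/EFin_inj; rewrite !tailE; apply: prob_ae_eq; do ?exact: measurable_gt.
apply: filterS intZ => w /intrP[k Zk] /=.
by rewrite Zk ltr_int -floor_lt_int.
Qed.

Lemma pmfZ_tail k : pmfZ Z k = tail Z (k - 1)%:~R - tail Z k%:~R.
Proof.
have k1 : ((k - 1)%:~R : R) <= k%:~R by rewrite ler_int gerBl.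
apply/EFin_inj; rewrite -prob_itvoc// /pmfZ /pmf fineK; last first.
  by rewrite fin_num_measure// -[X in measurable X]setTI; exact: measurable_funPT.
rewrite /distribution /= /pushforward; apply: prob_ae_eq.
- by rewrite -[X in measurable X]setTI; exact: measurable_funPT.
- by rewrite -[X in measurable X]setTI; exact: measurable_funPT.
apply: filterS intZ => w /intrP[l Zl] /=; rewrite Zl in_itv/= ltr_int ler_int.
split=> [/intr_inj ->|]; first by rewrite lexx gtrBl.
move=> /andP[kl lk]; congr (_%:~R); lia.
Qed.

End integer_valued.

Lemma exponential_rv_exists (R : realType) (lambda : R) : 0 < lambda ->
  exists d (T : measurableType d) (P : probability T R) (Z : {RV P >-> R}),
    exponential_rv Z lambda.
Proof.
move=> l0.
pose Q : probability (measurableTypeR R) R :=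
  exponential_distribution_exponential_prob__canonical__probability_measure_Probability l0.
have mid : measurable_fun [set: measurableTypeR R] (fun x => x : R).
  exact: (@measurable_id _ (measurableTypeR R)).
exists _, (measurableTypeR R), Q, (toRV Q mid); split => //.
- exact: measurable_exponential_pdf.
- by move=> x; rewrite exponential_pdf_ge0// ltW.
Qed.

Section geometric_law.
Context d (T : measurableType d) (R : realType) (P : probability T R).
Variables (X : {RV P >-> R}) (p : R).
Hypothesis p01 : 0 < p < 1.
Hypothesis geoX : geometric_rv X p.
Implicit Types (n k : nat).

(** X is distributed as the integer part of an exponential variable of this
    rate. *)
Definition geometric_rate : R := - ln (1 - p).
Local Notation q := (1 - p).
Local Notation lambda := geometric_rate.

Let p0 : 0 < p. Proof. by case/andP: p01. Qed.
Let q0 : 0 < q. Proof. by rewrite subr_gt0; case/andP: p01. Qed.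

Lemma geometric_rate_gt0 : 0 < lambda.
Proof. by rewrite oppr_gt0 ln_lt0// q0 gtrBl. Qed.

Lemma expR_rate n : expR (- (lambda * n%:R)) = q ^+ n.
Proof. by rewrite mulNr opprK mulrC expRM_natl lnK. Qed.

Let A n := [set w | exists2 k, (k < n)%N & X w = k%:R].

Let measurable_eq r : measurable [set w | X w = r].
Proof.
rewrite (_ : [set w | _] = X @^-1` [set r])//.
Qed.

Let AS n : A n.+1 = A n `|` [set w | X w = n%:R].
Proof.
apply/seteqP; split => w /=.
  by move=> [k]; rewrite ltnS leq_eqVlt => /predU1P[->|kn] Xk; [right|left; exists k].
by move=> [[k kn Xk]|Xn]; [exists k => //; exact: ltnW|exists n].
Qed.

Let mA n : measurable (A n).
Proof.
elim: n => [|n IH].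
  rewrite (_ : A 0 = set0)//; rewrite -subset0 => w [k]; by rewrite ltn0.
by rewrite AS; apply: measurableU.
Qed.

Let PA n : P (A n) = (1 - q ^+ n)%:E.
Proof.
elim: n => [|n IH].
  rewrite (_ : A 0 = set0) ?measure0 ?expr0 ?subrr//.
  by rewrite -subset0 => w [k]; rewrite ltn0.
have -> : P (A n.+1) = (P (A n) + P [set w | X w = n%:R])%E.
  rewrite AS; apply: measureU => //.
  rewrite -subset0 => w [[k kn Xk]] /=; rewrite Xk => /eqP.
  by rewrite eqr_nat => /eqP kn'; rewrite kn' ltnn in kn.
rewrite IH; have := geoX n; rewrite /pmf => pn.
have -> : P [set w | X w = n%:R] = (p * q ^+ n)%:E.
  by rewrite -pn fineK// fin_num_measure//; exact: measurable_eq.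
by rewrite -EFinD exprS; congr EFin; ring.
Qed.

Lemma geometric_nat : {ae P, forall w, exists k : nat, X w = k%:R}.
Proof.
exists (\bigcap_n ~` A n); split.
- by apply: bigcapT_measurable => n; exact: measurableC.
- apply/eqP; rewrite eq_le measure_ge0 andbT; apply/lee_addgt0Pr => e e0.
  rewrite add0e.
  have cv : q ^+ n @[n --> \oo] --> (0 : R).
    by apply: cvg_expr; rewrite gtr0_norm// gtrBl.
  have [n _ /(_ n (leqnn n)) /= qe] := cvgr_lt _ cv _ e0.
  apply: (@le_trans _ _ (P (~` A n))).
    apply: le_measure; rewrite ?inE.
    + by apply: bigcapT_measurable => k; exact: measurableC.
    + exact: measurableC.
    + by move=> w; apply.
  rewrite probability_setC// PA -EFinB lee_fin; lra.
- move=> w /= Xw n _ [k kn Xk]; apply: Xw; by exists k.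
Qed.

Lemma geometric_integer_valued : integer_valued X.
Proof. by apply: filterS geometric_nat => w [k ->]; exact: natr_int. Qed.

Lemma geometric_nonneg : {ae P, forall w, 0 <= X w}.
Proof. by apply: filterS geometric_nat => w [k ->]. Qed.

Lemma geometric_tail (n : int) : tail X n%:~R = exp_tail lambda (n%:~R + 1).
Proof.
have [n0|n0] := leP 0 n; last first.
  rewrite exp_tail_le0 ?geometric_rate_gt0//; last by rewrite -intrD1 lerz0; lia.
  apply/EFin_inj; rewrite tailE -[RHS](probability_setT P).
  apply: prob_ae_eq => //; first exact: measurable_gt.
  apply: filterS geometric_nonneg => w X0; split => // _ /=.
  by apply: lt_le_trans X0; rewrite ltrz0.
case: n n0 => // n _; rewrite -[(Posz n)%:~R]/(n%:R : R) natr1.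
rewrite exp_tail_ge0// ?geometric_rate_gt0// expR_rate.
suff : P [set w | X w <= n%:R] = (1 - q ^+ n.+1)%:E.
  by rewrite prob_le => -[] /eqP; rewrite (inj_eq (addrI _)) eqr_opp => /eqP.
rewrite -PA; apply: prob_ae_eq => //; first exact: measurable_le.
apply: filterS geometric_nat => w [k Xk] /=; rewrite Xk ler_nat; split=> [kn|].
  by exists k.
by move=> [l ln]; rewrite Xk => /eqP; rewrite eqr_nat => /eqP ->.
Qed.

Lemma geometric_tail_abs_nat n : tail (absRV X) n%:R = q ^+ n.+1.
Proof.
have /tail_same_law -> : same_law P (absRV X) X.
  apply: same_law_ae => //.
  by apply: filterS geometric_nonneg => w Xw /=; rewrite ger0_norm.
rewrite -[n%:R]/((Posz n)%:~R) geometric_tail -[(Posz n)%:~R]/(n%:R : R) natr1.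
by rewrite exp_tail_ge0 ?geometric_rate_gt0// expR_rate.
Qed.

(** The tails of X lie below those of an exponential variable. *)
Lemma geometric_sqr_integrable : (\int[P]_w (X w ^+ 2)%:E < +oo)%E.
Proof.
have l0 := geometric_rate_gt0.
have [d' [T' [Q [Z expZ]]]] := exponential_rv_exists l0.
apply: le_lt_trans (exponential_sqr_integrable l0 expZ).
apply: (le_integral_tail (Y := sqrRV Z) (Z := sqrRV X)).
- by move=> w; exact: sqr_ge0.
- by move=> w; exact: sqr_ge0.
move=> r r0; rewrite !tail_sqr//; set s := Num.sqrt r.
have s0 : 0 <= s by exact: sqrtr_ge0.
rewrite (exponential_tail_abs l0 expZ)//.
have sn : (Num.truncn s)%:R <= s < (Num.truncn s).+1%:R := truncn_itv s0.
move/andP: sn => [ns sn].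
apply: (le_trans (tail_le _ ns)); rewrite geometric_tail_abs_nat -expR_rate.
by rewrite ler_expR lerN2 ler_pM2l// ltW.
Qed.

End geometric_law.

Lemma absRV_integer d (T : measurableType d) (R : realType)
  (P : probability T R) (Z : {RV P >-> R}) :
  integer_valued Z -> integer_valued (absRV Z).
Proof.
by apply: filterS => w /intrP[k Zk] /=; rewrite Zk -intr_norm intr_int.
Qed.

Section geometric_symmetrizer.
Context d (T : measurableType d) (R : realType) (P : probability T R).
Variables (X Y : {RV P >-> R}) (p : R).
Hypothesis p01 : 0 < p < 1.
Hypothesis geoX : geometric_rv X p.
Hypothesis symXY : independent_symmetrizer X Y.
Hypothesis intY : integer_valued Y.
Implicit Types (x k : int) (n : nat).

Local Notation q := (1 - p).
Local Notation lambda := (geometric_rate p).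
Local Notation M x := (smooth Y lambda x%:~R).

Let lambda0 : 0 < lambda. Proof. exact: geometric_rate_gt0. Qed.
Let p0 : 0 < p. Proof. by case/andP: p01. Qed.
Let q0 : 0 < q. Proof. by rewrite subr_gt0; case/andP: p01. Qed.
Let rate1 : expR (- (lambda * 1)) = q.
Proof. by rewrite -[1]/(1%:R) (expR_rate p01) expr1. Qed.

Lemma geometric_sum_gt x : P [set w | x%:~R - 1 < X w + Y w] = (M x)%:E.
Proof.
have [indXY _] := symXY.
rewrite independent_sum_gt// /smooth /Rintegral fineK; last first.
  by apply: (integrable_fin_num measurableT); exact: integrable_exp_tail.
apply: ae_eq_integral => //.
- apply/measurable_EFinP; apply: (measurableT_comp (measurable_tail X)).
  exact: measurable_funB.
- by apply/measurable_EFinP; exact: measurable_shift.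
apply: filterS intY => w /intrP[k Yk] _; congr EFin; rewrite Yk.
rewrite (_ : x%:~R - 1 - k%:~R = (x - 1 - k)%:~R); last by rewrite !intrB.
rewrite (geometric_tail p01 geoX); congr (exp_tail _ _).
by rewrite !intrB; ring.
Qed.

(** Symmetry of X + Y: M x is the probability of X + Y >= x. *)
Lemma geometric_smooth_symmetric x : M x + M (1 - x) = 1.
Proof.
have [_ symS] := symXY.
have mS : measurable_fun [set: T] (X \+ Y) by exact: measurable_funD.
have intS : {ae P, forall w, X w + Y w \is a Num.int}.
  apply: filterS2 intY (geometric_integer_valued p01 geoX) => w Yw Xw.
  exact: rpredD.
have -> : M x = 1 - M (1 - x); last by rewrite subrK.
have := prob_le (toRV P mS) ((1 - x)%:~R - 1) => /=.
have -> : tail (toRV P mS) ((1 - x)%:~R - 1) = M (1 - x).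
  by apply/EFin_inj; rewrite -geometric_sum_gt tailE.
move=> E; apply/EFin_inj; rewrite -geometric_sum_gt -E.
have -> : P [set w | x%:~R - 1 < X w + Y w] = P [set w | x%:~R - 1 < - (X w + Y w)].
  by have := symS `](x%:~R - 1), +oo[%classic (measurable_itv _); rewrite !preimage_gt.
have mN : measurable_fun [set: T] (\- (X \+ Y)) by exact: measurableT_comp.
apply: prob_ae_eq.
- exact: (measurable_gt (toRV P mN)).
- exact: (measurable_le (toRV P mS)).
apply: filterS intS => w /intrP[k Sk] /=; rewrite Sk.
rewrite -[1]/(1%:~R) -!intrB -intrN ltr_int ler_int.
by split; lia.
Qed.

(** At integers the smoothing identity is exact: the increment of the tail of
    X + Y is proportional to the excess of this tail over that of Y. *)
Lemma geometric_smooth_decay x :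
  M x - M (x + 1) = p * (M x - tail Y x%:~R).
Proof.
rewrite smooth_sub_tail smooth_sub -RintegralZl//; last exact: integrable_excess.
congr fine; apply: ae_eq_integral => //.
- by apply/measurable_EFinP; apply: measurable_funB; exact: measurable_shift.
- apply/measurable_EFinP; apply: measurable_funM => //.
  by apply: measurable_funB; [exact: measurable_shift|exact: measurable_gt_indicator].
apply: filterS intY => w /intrP[k Yk] _; congr EFin; rewrite Yk ltr_int.
rewrite -!intrB; have [xk|kx] := ltP x k.
  rewrite !exp_tail_le0 ?subrr ?mulr0//.
    by rewrite lerz0; lia.
  by rewrite lerz0; lia.
rewrite subr0 !exp_tail_ge0 ?ler0z//; [|lia|lia].
rewrite (_ : (x + 1 - k)%:~R = (x - k)%:~R + 1); last by rewrite !intrD; ring.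
by rewrite mulrDr opprD expRD rate1; ring.
Qed.

(** The mass of X + Y outside of [- n, n - 1]. By remainingE it is also the mass
    of Y outside of [1 - n, n]. *)
Definition remaining n : R := M (Posz n) + M (Posz n + 1).

(** The decrements of M at n and at - n are equal by symmetry, hence so are the
    excesses of M over the tail of Y. *)
Lemma remainingE n :
  remaining n = tail Y n%:R + (1 - tail Y (- n%:R)).
Proof.
have := geometric_smooth_decay (Posz n); have := geometric_smooth_decay (- Posz n).
have := geometric_smooth_symmetric (- Posz n).
have := geometric_smooth_symmetric (Posz n + 1).
have -> : 1 - (Posz n + 1) = - Posz n by ring.
have -> : 1 - - Posz n = Posz n + 1 by ring.
have := geometric_smooth_symmetric (Posz n).
have -> : - Posz n + 1 = 1 - Posz n by ring.
rewrite /remaining -[n%:R : R]/((Posz n)%:~R) -intrN.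
move: (M (Posz n)) (M (Posz n + 1)) (M (- Posz n)) (M (1 - Posz n)) => a b a' b'.
move: (tail Y _) (tail Y _) => s s' E1 E2 _ E3 E4.
have E5 : p * (a' - s') = p * (a - s) by rewrite -E3 -E4; lra.
by move/(mulfI (lt0r_neq0 p0)): E5; lra.
Qed.

Lemma remaining0 : remaining 0 = 1.
Proof. by rewrite remainingE oppr0; ring. Qed.

Let posS n : Posz n.+1 = Posz n + 1. Proof. lia. Qed.

Let hazard x : q * M x <= M (x + 1).
Proof.
have := smooth_hazard Y lambda0 x%:~R (ler01 : 0 <= 1 :> R).
by rewrite rate1 intrD.
Qed.

Lemma remaining_hazard n : q * remaining n <= remaining n.+1.
Proof. by rewrite /remaining posS mulrDr; apply: lerD; exact: hazard. Qed.

Lemma remaining_decreasing n : remaining n.+1 < remaining n.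
Proof.
have leM x k : (x <= k) -> M k <= M x.
  by move=> xk; apply: smooth_le => //; rewrite ler_int.
suff lt : M (Posz n + 1) < M (Posz n).
  rewrite /remaining posS; apply: ltr_leD lt _; apply: leM; lia.
rewrite -subr_gt0 geometric_smooth_decay mulr_gt0// subr_gt0.
apply: smooth_tail_lt => //.
rewrite lt_neqAle tail_le1 andbT; apply/negP => /eqP Yn.
have M1 := smooth_tail_le Y lambda0 (Posz n)%:~R; rewrite Yn in M1.
have M0n : M (Posz n) <= M 0 by exact: leM.
have M01 := geometric_smooth_symmetric 0; have q01 := hazard 0.
rewrite subr0 in M01; rewrite add0r in q01.
have : 0 < q * M 0.
  apply: mulr_gt0; first exact: q0.
  exact: lt_le_trans ltr01 (le_trans M1 M0n).
move: M1 M0n M01 q01; move: (M 0) (M 1) (M (Posz n)) => a b c; lra.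
Qed.

Lemma cvg_remaining : remaining n @[n --> \oo] --> (0 : R).
Proof.
have mS : measurable_fun [set: T] (X \+ Y) by exact: measurable_funD.
have ME x : M x = tail (toRV P mS) (x%:~R - 1).
  by apply/EFin_inj; rewrite -geometric_sum_gt tailE.
have E : remaining = (fun n => tail (toRV P mS) (n%:R - 1) + tail (toRV P mS) n%:R).
  apply/funext => n; rewrite /remaining !ME intrD addrK.
  by [].
rewrite E -[X in _ --> X](addr0 (0 : R)).
have cv : tail (toRV P mS) n%:R @[n --> \oo] --> (0 : R).
  by apply: cvg_comp (cvg_tail_pinfty (toRV P mS)); exact: cvgr_idn.
apply: cvgD => //; rewrite -cvg_shiftS.
apply: cvg_trans cv; apply: near_eq_cvg; apply: nearW => n /=.
by rewrite -natr1 addrK.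
Qed.

Lemma remaining_ge n : q ^+ n <= remaining n.
Proof.
elim: n => [|n IH]; first by rewrite remaining0.
by apply: le_trans (remaining_hazard n); rewrite exprS ler_pM2l.
Qed.

(** The mass of Y at n + 1 and at -n is the decrement of the mass remaining
    outside of [1 - n, n]. *)
Lemma remaining_step n :
  remaining n - remaining n.+1 = pmfZ Y (Posz n + 1) + pmfZ Y (- Posz n).
Proof.
rewrite !remainingE !(pmfZ_tail intY) addrK.
have -> : (Posz n + 1)%:~R = n.+1%:R :> R by rewrite intrD natr1.
have -> : (- Posz n)%:~R = - n%:R :> R by rewrite intrN.
have -> : (- Posz n - 1)%:~R = - n.+1%:R :> R by rewrite -opprD intrN intrD natr1.
rewrite -[(Posz n)%:~R]/(n%:R : R); ring.
Qed.

Lemma integer_tail_abs n :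
  tail (absRV Y) n%:R = tail Y n%:R + (1 - tail Y (- n.+1%:R)).
Proof.
apply/EFin_inj; rewrite EFinD tailE -prob_le tailE.
have <- : P ([set w | n%:R < Y w]%R `|` [set w | Y w <= - n.+1%:R]%R) =
    (P [set w | n%:R < Y w]%R + P [set w | Y w <= - n.+1%:R]%R)%E.
  apply: measureU; [exact: measurable_gt|exact: measurable_le|].
  rewrite -subset0 => w [/= nY Yn].
  have := lt_le_trans nY Yn; rewrite ltNge; apply/negP; rewrite negbK.
  by rewrite (@le_trans _ _ 0)// oppr_le0.
apply: prob_ae_eq; first exact: measurable_gt.
  by apply: measurableU; [exact: measurable_gt|exact: measurable_le].
apply: filterS intY => w /intrP[k Yk] /=; rewrite Yk.
rewrite -[n%:R : R]/((Posz n)%:~R) -[n.+1%:R : R]/((Posz n.+1)%:~R) -intrN.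
rewrite -intr_norm !ltr_int ler_int; lia.
Qed.

Lemma remaining_tail_abs n : remaining n.+1 <= tail (absRV Y) n%:R.
Proof.
by rewrite remainingE integer_tail_abs lerD2r tail_le// ler_nat.
Qed.

Lemma geometric_tail_abs_le r : 0 <= r -> tail (absRV X) r <= tail (absRV Y) r.
Proof.
move=> r0; have iX := absRV_integer (geometric_integer_valued p01 geoX).
rewrite (integer_tail_floor iX) (integer_tail_floor (absRV_integer intY)).
have : (0 <= Num.floor r)%R by rewrite floor_ge0.
case: (Num.floor r) => // n _; rewrite -[(Posz n)%:~R]/(n%:R : R).
rewrite (geometric_tail_abs_nat p01 geoX).
by apply: le_trans (remaining_tail_abs n); exact: remaining_ge.
Qed.

(** Geometric decay of the remaining mass M n + M (n + 1) forces that of M, hence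
    Y has no mass on the positive integers. *)
Lemma same_law_of_geometric_remaining :
  (forall n, remaining n.+1 = q * remaining n) -> same_law P Y (\- X).
Proof.
move=> rq.
have remE n : remaining n = q ^+ n.
  by elim: n => [|n IH]; rewrite ?remaining0// rq IH exprS.
have Mq n : M (Posz n + 1) = q * M (Posz n).
  have := rq n; rewrite /remaining posS mulrDr.
  have := hazard (Posz n); have := hazard (Posz n + 1).
  move: (M (Posz n + 1 + 1)) (q * M (Posz n + 1)) (q * M (Posz n)).
  by move: (M (Posz n + 1)) => a b c e; lra.
have tail0 n : tail Y n%:R = 0.
  have := geometric_smooth_decay (Posz n); rewrite Mq.
  rewrite (_ : _ - _ = p * M (Posz n)); last by ring.
  move/(mulfI (lt0r_neq0 p0)) => /eqP; rewrite -subr_eq0 opprB addrC subrK.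
  by move/eqP.
have [_ symS] := symXY.
apply: (same_law_opp_of_abs symS).
- exact: (geometric_nonneg p01 geoX).
- exact: (geometric_sqr_integrable p01 geoX).
move=> r r0; have iX := absRV_integer (geometric_integer_valued p01 geoX).
rewrite (integer_tail_floor iX) (integer_tail_floor (absRV_integer intY)).
have : (0 <= Num.floor r)%R by rewrite floor_ge0.
case: (Num.floor r) => // n _; rewrite -[(Posz n)%:~R]/(n%:R : R).
rewrite (geometric_tail_abs_nat p01 geoX) integer_tail_abs tail0 add0r.
by have := remainingE n.+1; rewrite tail0 add0r remE.
Qed.

End geometric_symmetrizer.

(** * Entropies of integer-valued symmetrizers *)

Section sums.
Context (R : realType).
Local Open Scope ereal_scope.

Lemma esum_int_opp (a : int -> \bar R) :
  \esum_(k in [set: int]) a k = \esum_(k in [set: int]) a (- k)%R.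
Proof.
apply: (@reindex_esum R int int [set: int] [set: int] (fun k => - k)%R a).
split; [by []|by move=> x y _ _ /oppr_inj|].
by move=> k _; exists (- k)%R => //; rewrite opprK.
Qed.

(** The integers, enumerated by the pairs of n + 1 and -n. *)
Lemma esum_int_pairs (a : int -> \bar R) : (forall k, 0 <= a k) ->
  \esum_(k in [set: int]) a k =
  \sum_(n <oo) (a (Posz n + 1)%R + a (- Posz n)%R).
Proof.
move=> a0; rewrite (esumID [set k : int | (0 < k)%R])//.
rewrite nneseries_esumT; last by move=> n; rewrite adde_ge0.
rewrite esumD//; congr (_ + _).
- apply: (@reindex_esum R nat int [set: nat] _ (fun n => Posz n + 1)%R a).
  split.
  + by move=> n _ /=; split => //; lia.
  + by move=> n m _ _ /=; lia.
  + move=> k /= [_ k0]; exists (`|k|.-1)%N => //; lia.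
- apply: (@reindex_esum R nat int [set: nat] _ (fun n => - Posz n)%R a).
  split.
  + by move=> n _ /=; split => //; lia.
  + by move=> n m _ _ /=; lia.
  + move=> k /= [_ k0]; exists `|k|%N => //; lia.
Qed.

Lemma nneseries_of_cvg (a : nat -> R) l :
  (\sum_(n < N) a n)%R @[N --> \oo] --> l -> \sum_(n <oo) (a n)%:E = l%:E.
Proof.
move=> al; apply/cvg_lim => //.
have -> : (fun N => \sum_(0 <= n < N) (a n)%:E) =
    (fun N => (\sum_(n < N) a n)%R%:E).
  by apply/funext => N; rewrite big_mkord sumEFin.
by apply: cvg_EFin => //; exact: nearW.
Qed.

Lemma cvg_of_nneseries (a : nat -> R) l : (forall n, 0 <= a n)%R ->
  \sum_(n <oo) (a n)%:E = l%:E -> (\sum_(n < N) a n)%R @[N --> \oo] --> l.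
Proof.
move=> a0 al.
have : cvgn (fun N => \sum_(0 <= n < N) (a n)%:E).
  by apply: is_cvg_nneseries => n _ _; rewrite lee_fin.
move=> /cvgP; rewrite al => /fine_cvg; apply: cvg_trans; apply: near_eq_cvg.
by apply: nearW => N /=; rewrite big_mkord sumEFin.
Qed.

End sums.

Section discrete_comparison.
Context d (T : measurableType d) (R : realType) (P : probability T R).
Variables (X Y : {RV P >-> R}) (p : R).
Hypothesis p01 : 0 < p < 1.
Hypothesis geoX : geometric_rv X p.
Hypothesis symXY : independent_symmetrizer X Y.
Hypothesis intY : integer_valued Y.

Local Notation q := (1 - p).

Let q01 : 0 < q < 1.
Proof. by case/andP: p01 => p0 p1; rewrite subr_gt0 p1 gtrBl. Qed.

Local Notation D := (remaining Y p).
Local Notation g n := (D n - D n.+1).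
Local Notation f := (pmfZ Y).

Let D0 : D 0%N = 1. Proof. exact: (remaining0 p01 geoX symXY intY). Qed.
Let Dq n : q * D n <= D n.+1. Proof. exact: remaining_hazard. Qed.
Let Dlt n : D n.+1 < D n.
Proof. exact: (remaining_decreasing p01 geoX symXY intY). Qed.
Let Dcvg : D n @[n --> \oo] --> (0 : R).
Proof. exact: (cvg_remaining p01 geoX symXY intY). Qed.

Lemma pmfZ_ge0 (Z : {RV P >-> R}) k : 0 <= pmfZ Z k.
Proof. exact: pmf_ge0. Qed.

Lemma pmfZ_le1 (Z : {RV P >-> R}) k : pmfZ Z k <= 1.
Proof. by rewrite /pmfZ /pmf -lee_fin fineK ?fin_num_measure// probability_le1. Qed.

Lemma pmfZ_mirror : same_law P Y (\- X) -> forall k, pmfZ Y k = pmfZ X (- k).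
Proof.
move=> law k; rewrite /pmfZ /pmf law//; congr (fine (P _)).
apply/seteqP; split => w /= E; first by rewrite intrN -E opprK.
by rewrite E intrN opprK.
Qed.

Variable phi : R -> R.
Hypothesis phi0 : phi 0 = 0.
Hypothesis phi_ge0 : forall t, 0 <= t <= 1 -> 0 <= phi t.

Local Notation sumX := (\esum_(k in [set: int]) (phi (pmfZ X k))%:E)%E.
Local Notation sumY := (\esum_(k in [set: int]) (phi (pmfZ Y k))%:E)%E.

Let phi_pmf (Z : {RV P >-> R}) k : (0 <= (phi (pmfZ Z k))%:E)%E.
Proof. by rewrite lee_fin phi_ge0// pmfZ_ge0 pmfZ_le1. Qed.

Lemma esum_mirror : same_law P Y (\- X) -> sumY = sumX.
Proof.
move=> /pmfZ_mirror YX; rewrite [RHS]esum_int_opp.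
by apply: eq_esum => k _; rewrite YX.
Qed.

Let sumXE : sumX = (\sum_(n <oo) (phi (q ^+ n - q ^+ n.+1))%:E)%E.
Proof.
rewrite esum_int_opp esum_int_pairs//.
apply: eq_eseriesr => n _.
have -> : pmfZ X (- (Posz n + 1)) = 0.
  rewrite (pmfZ_tail (geometric_integer_valued p01 geoX)).
  rewrite !(geometric_tail p01 geoX).
  rewrite !exp_tail_le0 ?subrr ?(geometric_rate_gt0 p01)//.
rewrite phi0 add0e opprK; congr (phi _)%:E.
have := geoX n; rewrite /pmfZ -[(Posz n)%:~R]/(n%:R : R) => ->.
by rewrite exprS; ring.
Qed.

Let sumYE : sumY = (\sum_(n <oo) (phi (f (Posz n + 1)) + phi (f (- Posz n)))%:E)%E.
Proof. by rewrite esum_int_pairs. Qed.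

Let gE n : g n = f (Posz n + 1) + f (- Posz n).
Proof. exact: (remaining_step p01 geoX symXY intY). Qed.

Let g01 n : 0 <= g n <= 1.
Proof.
rewrite subr_ge0 ltW//=.
have Dn := remaining_mass_gt0 q01 D0 Dq.
have D1 : D n <= 1.
  elim: (n) => [|m IH]; first by rewrite D0.
  exact: le_trans (ltW (Dlt m)) IH.
by have := Dn n.+1; move: D1; move: (D n) (D n.+1) => a b; lra.
Qed.

Section concave.
Variable Phi : R -> R.
Hypothesis V : value_function q phi Phi.

Let sumX_value : sumX = (Phi 1)%:E.
Proof. by rewrite sumXE; apply: nneseries_of_cvg; exact: value_function_geometric. Qed.

Let sum_g_le : (\sum_(n <oo) (phi (g n))%:E <= sumY)%E.
Proof.
rewrite sumYE; apply: lee_nneseries => n _; first by rewrite lee_fin phi_ge0.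
by rewrite lee_fin gE (value_function_subadditive V)// pmfZ_ge0.
Qed.

Let sum_g_value : ((Phi 1)%:E <= \sum_(n <oo) (phi (g n))%:E)%E /\
  ((\sum_(n <oo) (phi (g n))%:E = (Phi 1)%:E)%E -> forall n, D n.+1 = q * D n).
Proof.
have S0 : (0 <= \sum_(n <oo) (phi (g n))%:E)%E.
  by apply: nneseries_ge0 => n _ _; rewrite lee_fin phi_ge0.
case S : (\sum_(n <oo) (phi (g n))%:E)%E S0 => [l||]// _; last by rewrite leey.
have := cvg_of_nneseries (fun n => phi_ge0 (g01 n)) S.
move=> /(value_function_limit q01 V D0 Dq Dlt Dcvg)[le eq].
by rewrite lee_fin; split => // -[].
Qed.

(** Merging the masses of Y at n + 1 and - n only decreases the sum, and the
    merged masses are the decrements of the remaining mass, whose hazard is at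
    most 1 - q. *)
Lemma concave_sum_le : (sumX <= sumY)%E.
Proof. by rewrite sumX_value; exact: le_trans sum_g_value.1 sum_g_le. Qed.

Lemma concave_sum_eq : sumY = sumX -> same_law P Y (\- X).
Proof.
rewrite sumX_value => E; apply: (same_law_of_geometric_remaining p01 geoX symXY intY).
apply: sum_g_value.2; apply/eqP; rewrite eq_le sum_g_value.1 andbT -E.
exact: sum_g_le.
Qed.

End concave.

(** Now merging increases the sum; that the merged sum converges has to be
    deduced from its partial sums, with the sign of Phi. *)
Section convex.
Variable Phi : R -> R.
Hypothesis V : value_function q (fun t => - phi t) Phi.
Hypothesis Phi_le0 : forall t, 0 < t -> Phi t <= 0.

Let sumX_value : sumX = (- Phi 1)%:E.
Proof.
rewrite sumXE; apply: nneseries_of_cvg.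
have -> : (fun N => \sum_(n < N) phi (q ^+ n - q ^+ n.+1)) =
    (fun N => - \sum_(n < N) - phi (q ^+ n - q ^+ n.+1)).
  by apply/funext => N; rewrite sumrN opprK.
apply: cvgN; have V1 := value_function_geometric q01 V; exact: V1.
Qed.

Let sum_g_ge : (sumY <= \sum_(n <oo) (phi (g n))%:E)%E.
Proof.
rewrite sumYE; apply: lee_nneseries => n _.
  by rewrite lee_fin addr_ge0// -lee_fin.
rewrite lee_fin gE -lerN2 opprD.
exact: (value_function_subadditive V (pmfZ_ge0 _ _) (pmfZ_ge0 _ _)).
Qed.

Let sum_g_value : (\sum_(n <oo) (phi (g n))%:E <= (- Phi 1)%:E)%E /\
  ((\sum_(n <oo) (phi (g n))%:E = (- Phi 1)%:E)%E -> forall n, D n.+1 = q * D n).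
Proof.
have S0 : (0 <= \sum_(n <oo) (phi (g n))%:E)%E.
  by apply: nneseries_ge0 => n _ _; rewrite lee_fin phi_ge0.
have Sle : (\sum_(n <oo) (phi (g n))%:E <= (- Phi 1)%:E)%E.
  apply: lime_le.
    by apply: is_cvg_nneseries => n _ _; rewrite lee_fin phi_ge0.
  apply: nearW => N; rewrite big_mkord sumEFin lee_fin.
  have := value_function_partial q01 V D0 Dq Dlt N.
  have := Phi_le0 (remaining_mass_gt0 q01 D0 Dq N).
  by rewrite sumrN; move: (Phi _) (\sum_(_ < _) _) => a b; lra.
split => // S.
have SN : \sum_(n < N) - phi (g n) @[N --> \oo] --> Phi 1.
  rewrite -[Phi 1]opprK (_ : (fun N => _) = (fun N => - \sum_(n < N) phi (g n))).
    by apply: cvgN; exact: cvg_of_nneseries (fun n => phi_ge0 (g01 n)) S.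
  by apply/funext => N; rewrite sumrN.
exact: (value_function_limit q01 V D0 Dq Dlt Dcvg SN).2.
Qed.

Lemma convex_sum_le : (sumY <= sumX)%E.
Proof. by rewrite sumX_value; exact: le_trans sum_g_ge sum_g_value.1. Qed.

Lemma convex_sum_eq : sumY = sumX -> same_law P Y (\- X).
Proof.
rewrite sumX_value => E; apply: (same_law_of_geometric_remaining p01 geoX symXY intY).
apply: sum_g_value.2; apply/eqP; rewrite eq_le sum_g_value.1 andTb -E.
exact: sum_g_ge.
Qed.

End convex.

End discrete_comparison.

Section geometric_entropies.
Context d (T : measurableType d) (R : realType) (P : probability T R).
Variables (X Y : {RV P >-> R}) (p : R).
Hypothesis p01 : 0 < p < 1.
Hypothesis geoX : geometric_rv X p.
Hypothesis symXY : independent_symmetrizer X Y.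
Hypothesis intY : integer_valued Y.

Let q01 : 0 < 1 - p < 1.
Proof. by case/andP: p01 => p0 p1; rewrite subr_gt0 p1 gtrBl. Qed.

Lemma geometric_entropies alpha : 0 < alpha ->
  [/\ (drenyi alpha (pmfZ X) <= drenyi alpha (pmfZ Y))%E,
      (drenyi alpha (pmfZ Y) = drenyi alpha (pmfZ X) <-> same_law P Y (\- X)),
      (dtsallis alpha (pmfZ X) <= dtsallis alpha (pmfZ Y))%E &
      (dtsallis alpha (pmfZ Y) = dtsallis alpha (pmfZ X) <->
        same_law P Y (\- X))].
Proof.
move=> a0; rewrite /drenyi /dtsallis /dshannon; case: eqVneq => [_|a1].
  have phi0 : - (0 * ln 0) = 0 :> R by rewrite mul0r oppr0.
  have phi_ge0 t : 0 <= t <= 1 -> 0 <= - (t * ln t) :> R.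
    by move=> /andP[t0 t1]; rewrite oppr_ge0 mulr_ge0_le0// ln_le0.
  have V := shannon_value_function q01.
  have le := concave_sum_le p01 geoX symXY intY phi0 phi_ge0 V.
  have eq := concave_sum_eq p01 geoX symXY intY phi0 phi_ge0 V.
  have mirror := esum_mirror (fun t => - (t * ln t)).
  by split => //; split => [|/mirror].
have pow0 : 0 `^ alpha = 0 :> R by rewrite powR0// gt_eqF.
have pow_ge0 t : 0 <= t <= 1 -> 0 <= t `^ alpha :> R by move=> _; exact: powR_ge0.
have sum0 (h : int -> R) : (0 <= \esum_(k in [set: int]) (h k `^ alpha)%:E)%E.
  by apply: esum_ge0 => k _; rewrite lee_fin powR_ge0.
have [le eq] : (if (alpha < 1)%R
    then \esum_(k in [set: int]) (pmfZ X k `^ alpha)%:E <=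
         \esum_(k in [set: int]) (pmfZ Y k `^ alpha)%:E
    else \esum_(k in [set: int]) (pmfZ Y k `^ alpha)%:E <=
         \esum_(k in [set: int]) (pmfZ X k `^ alpha)%:E)%E /\
  ((\esum_(k in [set: int]) (pmfZ Y k `^ alpha)%:E =
    \esum_(k in [set: int]) (pmfZ X k `^ alpha)%:E)%E -> same_law P Y (\- X)).
  case: ifPn => [lt1|]; last rewrite -leNgt => ge1.
    have V := power_value_function_lt1 q01 a0 lt1.
    split; first exact: (concave_sum_le p01 geoX symXY intY pow0 pow_ge0 V).
    exact: (concave_sum_eq p01 geoX symXY intY pow0 pow_ge0 V).
  have gt1 : 1 < alpha by rewrite lt_neqAle eq_sym a1.
  have V := power_value_function_gt1 q01 a0 gt1.
  have V0 t (_ : 0 < t) := power_value_function_le0 q01 a0 t.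
  split; first exact: (convex_sum_le p01 geoX symXY intY pow0 pow_ge0 V V0).
  exact: (convex_sum_eq p01 geoX symXY intY pow0 pow_ge0 V V0).
have mirror := @esum_mirror _ _ _ _ X Y (fun t => t `^ alpha).
have [r1 r2 t1 t2] := power_entropies a1 (sum0 (pmfZ X)) (sum0 (pmfZ Y)) le.
split; [exact: r1|exact: (iff_trans r2 (conj eq mirror))|exact: t1|exact: (iff_trans t2 (conj eq mirror))].
Qed.

End geometric_entropies.

(** * Entropies and variance of symmetrizers *)

Local Close Scope classical_set_scope.
Local Open Scope ereal_scope.

Theorem theorem1p1 (d : measure_display) (T : measurableType d) (R : realType)
    (P : probability T R) (X Y : {RV P >-> R})
    (symXY : independent_symmetrizer X Y) :
  (forall lambda : R, (0 < lambda)%R -> exponential_rv X lambda ->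
    [/\ distribution P Y `<< (@lebesgue_measure R),
        (forall (alpha : R) (fX fY : R -> R), (0 < alpha)%R ->
          is_density X fX -> is_density Y fY ->
          [/\ renyi alpha fX <= renyi alpha fY,
              (renyi alpha fY = renyi alpha fX <-> same_law P Y (\- X)%R),
              tsallis alpha fX <= tsallis alpha fY &
              (tsallis alpha fY = tsallis alpha fX <-> same_law P Y (\- X)%R)]),
        'V_P[X] <= 'V_P[Y] &
        ('V_P[Y] = 'V_P[X] <-> same_law P Y (\- X)%R)]) /\
  (forall p : R, (0 < p < 1)%R -> geometric_rv X p -> integer_valued Y ->
    [/\ (forall alpha : R, (0 < alpha)%R ->
          [/\ drenyi alpha (pmfZ X) <= drenyi alpha (pmfZ Y),
              (drenyi alpha (pmfZ Y) = drenyi alpha (pmfZ X) <->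
                same_law P Y (\- X)%R),
              dtsallis alpha (pmfZ X) <= dtsallis alpha (pmfZ Y) &
              (dtsallis alpha (pmfZ Y) = dtsallis alpha (pmfZ X) <->
                same_law P Y (\- X)%R)]),
        'V_P[X] <= 'V_P[Y] &
        ('V_P[Y] = 'V_P[X] <-> same_law P Y (\- X)%R)]).
Proof.
have [_ symS] := symXY; split=> [lambda lambda0 expX|p p01 geoX intY].
- have X0 := exponential_nonneg expX.
  have X2 := exponential_sqr_integrable lambda0 expX.
  have YX := exponential_tail_abs_le lambda0 expX symXY.
  split.
  + exact: (exponential_symmetrizer_dominates lambda0 expX symXY).
  + move=> alpha fX fY alpha0 XfX YfY.
    exact: (exponential_entropies lambda0 expX symXY XfX YfY alpha0).
  + exact: (variance_le_of_abs symS X2 YX).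
  + exact: (variance_eq_of_abs symS X0 X2 YX).
- have X0 := geometric_nonneg p01 geoX.
  have X2 := geometric_sqr_integrable p01 geoX.
  have YX := geometric_tail_abs_le p01 geoX symXY intY.
  split.
  + move=> alpha alpha0.
    exact: (geometric_entropies p01 geoX symXY intY alpha0).
  + exact: (variance_le_of_abs symS X2 YX).
  + exact: (variance_eq_of_abs symS X0 X2 YX).
Qed.
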